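(* There exist real-analytic sub-Riemannian manifolds admitting branching strictly abnormal minimizing geodesics. Concretely, in the polynomial sub-Riemannian manifold $\mathcal M$ (for any odd $b\ge5$) there are $s,\varepsilon>0$ such that the strictly abnormal minimizing geodesics $\gamma|_{[-s,\varepsilon]}$ and $\bar\gamma|_{[-s,\varepsilon]}$ (reparametrized by arc length) coincide on $[-s,0]$ and differ on $[-s,\tau]$ for every $\tau\in(0,\varepsilon]$.
   Context: Fix an odd integer $b\geq5$ and set $q=b/2$. Let $P(x)=x_1^2-x_2^b$. On $\mathbb{R}^3$ let $X_1=\partial_{x_1}$, $X_2=\partial_{x_2}+P(x)^2\partial_{x_3}$, and let $\mathcal M=(\mathbb{R}^3,\mathrm{span}\{X_1,X_2\},g)$ with $g$ making $\{X_1,X_2\}$ orthonormal. Horizontal curves, their length $L_{\rm SR}$ and the distance $d_{\rm SR}$ are defined as usual; a minimizing geodesic is an arc-length parametrized horizontal curve realizing the distance between its endpoints. $\gamma(t)=\bar\gamma(t)=(0,t,\tfrac{t^{2b+1}}{2b+1})$ for $t<0$, $\gamma(t)=(t^q,t,0)$ and $\bar\gamma(t)=(-t^q,t,0)$ for $t\ge0$. A minimizing geodesic $\eta:[0,T]\to M$ is branching at $t\in(0,T)$ if there is a minimizing geodesic $\eta':[0,T]\to M$ with $\eta|_{[0,t]}=\eta'|_{[0,t]}$ and $\eta|_{[0,\tau]}\ne\eta'|_{[0,\tau]}$ for all $\tau\in(t,T]$. A curve is strictly abnormal if it is an abnormal extremal (in the sense of the Pontryagin Maximum Principle) but not a normal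 one. *)

(* Defs.v *)
From HB Require Import structures.
From mathcomp Require Import all_boot all_order all_algebra.
From mathcomp Require Import all_classical all_reals all_analysis.
Set Implicit Arguments. Unset Strict Implicit. Unset Printing Implicit Defensive.
Import Order.TTheory GRing.Theory Num.Theory.
Import numFieldNormedType.Exports.
Local Open Scope classical_set_scope.
Local Open Scope ring_scope.

(* Sub-Riemannian structures on R^n given by a global frame            *)
(* X_1,...,X_m of vector fields declared orthonormal (the frames used   *)
(* below are pointwise linearly independent).  Points and covectors     *)
(* are row vectors 'rV[R]_n.                                            *)
Section SubRiemannian.
Variable R : realType.

Definition frame (m n : nat) := 'I_m -> 'rV[R]_n -> 'rV[R]_n.

Definition pairing n (lam v : 'rV[R]_n) : R := \sum_(j < n) lam ord0 j * v ord0 j.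

(* Euclidean norm of a control value (the frame is orthonormal) *)
Definition cnorm m (w : 'rV[R]_m) : R := Num.sqrt (\sum_(i < m) w ord0 i ^+ 2).

(* (eta, u) is an admissible pair on [a,b]: u is an L^infty control and
   eta is the corresponding trajectory, eta' = sum_i u_i X_i(eta) a.e.,
   written in integral form (such eta are exactly the horizontal,
   Lipschitz curves). *)
Definition admissible m n (X : frame m n) (a b : R)
    (eta : R -> 'rV[R]_n) (u : R -> 'rV[R]_m) : Prop :=
  [/\ a <= b,
      (forall i, measurable_fun `[a, b] (fun t => u t ord0 i)),
      (exists M : R, forall t, a <= t <= b -> forall i, `|u t ord0 i| <= M),
      (forall j, (@lebesgue_measure R).-integrable `[a, b]
          (fun t => (\sum_(i < m) u t ord0 i * X i (eta t) ord0 j)%:E)) &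
      (forall t, a <= t <= b -> forall j,
         eta t ord0 j = eta a ord0 j +
           Rintegral (@lebesgue_measure R) `[a, t]
             (fun s => \sum_(i < m) u s ord0 i * X i (eta s) ord0 j))].

Definition sr_length m (u : R -> 'rV[R]_m) (a b : R) : R :=
  Rintegral (@lebesgue_measure R) `[a, b] (fun t => cnorm (u t)).

(* sub-Riemannian distance (infimum of lengths, +oo if no curve) *)
Definition sr_dist m n (X : frame m n) (p q : 'rV[R]_n) : \bar R :=
  ereal_inf [set l | exists (a b : R) (eta : R -> 'rV[R]_n) (u : R -> 'rV[R]_m),
     [/\ admissible X a b eta u, eta a = p, eta b = q & l = (sr_length u a b)%:E]].

Definition minimizing_geodesic m n (X : frame m n) (T : R) (eta : R -> 'rV[R]_n) :=
  exists u : R -> 'rV[R]_m,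
    [/\ admissible X 0 T eta u,
        (forall t, 0 <= t <= T -> cnorm (u t) = 1) &
        sr_dist X (eta 0) (eta T) = T%:E].

Definition dpair n (Y : 'rV[R]_n -> 'rV[R]_n) (lam x : 'rV[R]_n) (j : 'I_n) : R :=
  derive (fun y : 'rV[R]_n => pairing lam (Y y)) x (delta_mx ord0 j).

(* adjoint (covector) equation of the PMP:
   lam' = - d/dx ( sum_i u_i <lam, X_i(x)> ), in integral form *)
Definition adjoint_eq m n (X : frame m n) (T : R) (eta : R -> 'rV[R]_n)
    (u : R -> 'rV[R]_m) (lam : R -> 'rV[R]_n) : Prop :=
  (forall j, (@lebesgue_measure R).-integrable `[0, T]
       (fun s => (\sum_(i < m) u s ord0 i * dpair (X i) (lam s) (eta s) j)%:E)) /\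
  (forall t, 0 <= t <= T -> forall j,
     lam t ord0 j = lam 0 ord0 j -
       Rintegral (@lebesgue_measure R) `[0, t]
         (fun s => \sum_(i < m) u s ord0 i * dpair (X i) (lam s) (eta s) j)).

Definition abnormal_extremal m n (X : frame m n) (T : R) (eta : R -> 'rV[R]_n) :=
  exists (u : R -> 'rV[R]_m) (lam : R -> 'rV[R]_n),
    [/\ admissible X 0 T eta u, adjoint_eq X T eta u lam,
        (forall t, 0 <= t <= T -> lam t != 0) &
        (forall t, 0 <= t <= T -> forall i, pairing (lam t) (X i (eta t)) = 0)].

(* normal extremal: projection of a solution of the normal Hamiltonian
   system, H = 1/2 sum_i <lam, X_i>^2, i.e. u_i = <lam, X_i(eta)> *)
Definition normal_extremal m n (X : frame m n) (T : R) (eta : R -> 'rV[R]_n) :=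
  exists (u : R -> 'rV[R]_m) (lam : R -> 'rV[R]_n),
    [/\ admissible X 0 T eta u, adjoint_eq X T eta u lam &
        (forall t, 0 <= t <= T -> forall i, u t ord0 i = pairing (lam t) (X i (eta t)))].

Definition strictly_abnormal m n (X : frame m n) (T : R) (eta : R -> 'rV[R]_n) :=
  abnormal_extremal X T eta /\ ~ normal_extremal X T eta.

(* coordinates x_1, x_2, x_3 are the entries 0, 1, 2 of the row vector  *)
Definition vec3 (a1 a2 a3 : R) : 'rV[R]_3 := \row_(j < 3) [:: a1; a2; a3]`_j.

Definition Pb (b : nat) (x : 'rV[R]_3) : R :=
  x ord0 (inord 0) ^+ 2 - x ord0 (inord 1) ^+ b.

Definition Mframe (b : nat) : frame 2 3 :=
  fun i x => if i == ord0 then vec3 1 0 0 else vec3 0 1 (Pb b x ^+ 2).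

Definition gammaM (b : nat) (t : R) : 'rV[R]_3 :=
  if t < 0 then vec3 0 t (t ^+ (2 * b + 1) / (2 * b + 1)%:R)
  else vec3 (t `^ (b%:R / 2)) t 0.

Definition gammabarM (b : nat) (t : R) : 'rV[R]_3 :=
  if t < 0 then vec3 0 t (t ^+ (2 * b + 1) / (2 * b + 1)%:R)
  else vec3 (- t `^ (b%:R / 2)) t 0.

End SubRiemannian.

(* Main.v *)
Require Import Defs.
From HB Require Import structures.
From mathcomp Require Import all_boot all_order all_algebra.
From mathcomp Require Import all_classical all_reals all_analysis.
From mathcomp Require Import measurable_realfun zify ring lra.
Import Order.TTheory GRing.Theory Num.Theory.
Import numFieldNormedType.Exports.
Set Implicit Arguments.
Unset Strict Implicit.
Local Open Scope classical_set_scope.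
Local Open Scope ring_scope.

(* Let q(y) = y^(2b) for y < 0 and 0 for y >= 0.  The excess E = P^2 - q(x_2) is
   nonnegative and vanishes on both curves.  A competitor (x, y) with the same end
   points satisfies int E dy = 0, so it has to move backwards in y in order to leave
   {E = 0}.  Let w(y) be the profile y^(b/2) (0 for y <= 0), and calibrate the length
   by the unit covector (sin theta, cos theta) with tan theta = w'(y).  Writing e >= 0
   for the calibration deficit and integrating by parts,
     length(competitor) - length(gamma) = int e - G,
     G = int (x - w(y)) (sin theta)'(y) dy.
   Suppose this is negative, so that int e < G.  As |u| <= 2 y' + 2 e, one gets
   int E |u| <= 2 (max E) int e, and since sqrt E is Lipschitz with a small constant,
   (max E)^2 <= (max E)^(1/2) int E |u|.  Hence max E = O(G^2) and int E |u| = O(G^3).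
   With G = k^3, the integrand of G is bounded pointwise by
     (3/8) e + E |u| / (64 G^2) + d/dt ((G/32) atan(y/k)),
   which gives the contradiction G <= (5/8) G. *)

(** The calibration alone fails: where y > 0, x > w(y) and y' > 0, the integrand of G is positive
    and linear in the deviation d = x - w(y), whereas E only controls d^4 and 4 d^2 w^2, so no fixed
    multiple of E absorbs it. The bound int E |u| = O(G^3) is what allows E to be charged with the
    large factor 1/(64 G^2). What is then left over is bounded by a function of y alone, hence
    becomes an exact derivative along the competitor: however often y runs back and forth, only its
    end values count. Backward motion itself is charged to e, because -y' <= e.

    The scale y ~ k is forced by homogeneity. At d ~ k^2 the charge d^4 / k^6 has the size k^2 of d,
    and a remainder of height k^2 on a y-interval of length k has mass k^3 = G. Beyond that scale w
    is large enough for the term 4 d^2 w^2 to take over, and this leaves the integrable tail of the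
    derivative of atan(y/k). *)

(** * Bounded measurable functions and their integrals *)

Definition bmeas {R : realType} (a b : R) (f : R -> R) : Prop :=
  measurable_fun `[a, b] f /\ exists M, forall t, a <= t <= b -> `|f t| <= M.

Definition Int {R : realType} (a b : R) (f : R -> R) : R :=
  Rintegral (@lebesgue_measure R) `[a, b] f.

Lemma eq_Int {R : realType} (a b : R) (f g : R -> R) :
  (forall t, a <= t <= b -> f t = g t) -> Int a b f = Int a b g.
Proof. by move=> fg; apply: eq_Rintegral => t; rewrite inE/= in_itv/= => /fg. Qed.

Lemma eq_bmeas {R : realType} (a b : R) (f g : R -> R) :
  (forall t, a <= t <= b -> f t = g t) -> bmeas a b f -> bmeas a b g.
Proof.
move=> fg [mf [M fM]]; split; last by exists M => t tab; rewrite -fg// fM.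
by apply: eq_measurable_fun mf => t; rewrite inE/= in_itv/= => /fg.
Qed.

Lemma bmeas_integrable {R : realType} (a b : R) (f : R -> R) : bmeas a b f ->
  (@lebesgue_measure R).-integrable `[a, b] (EFin \o f).
Proof.
move=> [mf [M fM]]; apply: measurable_bounded_integrable => //.
  by apply: compact_finite_measure; exact: segment_compact.
exists M; split; rewrite ?num_real// => N MN t /=; rewrite in_itv/= => /fM.
by move=> /le_trans; apply; exact: ltW.
Qed.

Lemma bmeas_sub {R : realType} (a b c d : R) (f : R -> R) :
  a <= c -> d <= b -> bmeas a b f -> bmeas c d f.
Proof.
move=> ac db [mf [M fM]]; split.
  apply: measurable_funS mf => // t /=; rewrite !in_itv/= => /andP[ct td].
  by rewrite (le_trans ac ct) (le_trans td db).
exists M => t /andP[ct td]; apply: fM.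
by rewrite (le_trans ac ct) (le_trans td db).
Qed.

Lemma bmeas_cst {R : realType} (a b k : R) : bmeas a b (fun=> k).
Proof. by split; [exact: measurable_cst|exists `|k|]. Qed.

Lemma bmeasD {R : realType} (a b : R) (f g : R -> R) :
  bmeas a b f -> bmeas a b g -> bmeas a b (fun t => f t + g t).
Proof.
move=> [mf [M fM]] [mg [N gN]]; split; first exact: measurable_funD.
exists (M + N) => t tab; rewrite (le_trans (ler_normD _ _))// lerD//.
  exact: fM.
exact: gN.
Qed.

Lemma bmeasM {R : realType} (a b : R) (f g : R -> R) :
  bmeas a b f -> bmeas a b g -> bmeas a b (fun t => f t * g t).
Proof.
move=> [mf [M fM]] [mg [N gN]]; split; first exact: measurable_funM.
by exists (M * N) => t tab; rewrite normrM ler_pM// ?fM ?gN.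
Qed.

Lemma bmeasZ {R : realType} (a b k : R) (f : R -> R) :
  bmeas a b f -> bmeas a b (fun t => k * f t).
Proof. by move=> ?; apply: bmeasM => //; exact: bmeas_cst. Qed.

Lemma bmeasB {R : realType} (a b : R) (f g : R -> R) :
  bmeas a b f -> bmeas a b g -> bmeas a b (fun t => f t - g t).
Proof.
move=> bf bg; apply: (@eq_bmeas _ _ _ (fun t => f t + -1 * g t)).
  by move=> t _; rewrite mulN1r.
by apply: bmeasD => //; exact: bmeasZ.
Qed.

(** The values of [f] lie in a compact interval, on which the continuous [phi] is bounded. *)
Lemma bmeas_continuous {R : realType} (a b : R) (phi f : R -> R) :
  continuous phi -> bmeas a b f -> bmeas a b (phi \o f).
Proof.
move=> cphi [mf [M fM]]; split.
  by apply: measurableT_comp => //; exact: continuous_measurable_fun.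
have [ab|ba] := leP a b; last first.
  by exists 0 => t /andP[a_t tb]; move: ba; rewrite ltNge (le_trans a_t tb).
have M0 : - M <= M.
  by have : `|f a| <= M by [apply: fM; rewrite lexx ab]; move: (normr_ge0 (f a)); lra.
have cn : {within `[- M, M], continuous (fun x => `|phi x|)}.
  apply: continuous_subspaceT => x.
  by apply: continuous_comp; [exact: cphi|exact: norm_continuous].
have [c _ hc] := EVT_max M0 cn.
exists `|phi c| => t /fM; rewrite ler_norml => fMt.
by apply: hc; rewrite in_itv.
Qed.

Lemma IntD {R : realType} (a b : R) (f g : R -> R) : bmeas a b f -> bmeas a b g ->
  Int a b (fun t => f t + g t) = Int a b f + Int a b g.
Proof. by move=> bf bg; apply: RintegralD => //; exact: bmeas_integrable. Qed.

Lemma IntB {R : realType} (a b : R) (f g : R -> R) : bmeas a b f -> bmeas a b g ->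
  Int a b (fun t => f t - g t) = Int a b f - Int a b g.
Proof. by move=> bf bg; apply: RintegralB => //; exact: bmeas_integrable. Qed.

Lemma IntZ {R : realType} (a b k : R) (f : R -> R) : bmeas a b f ->
  Int a b (fun t => k * f t) = k * Int a b f.
Proof. by move=> bf; apply: RintegralZl => //; exact: bmeas_integrable. Qed.

Lemma le_Int {R : realType} (a b : R) (f g : R -> R) : bmeas a b f -> bmeas a b g ->
  (forall t, a <= t <= b -> f t <= g t) -> Int a b f <= Int a b g.
Proof.
by move=> bf bg fg; apply: le_Rintegral => //; exact: bmeas_integrable.
Qed.

Lemma Int_ge0 {R : realType} (a b : R) (f : R -> R) :
  (forall t, a <= t <= b -> 0 <= f t) -> 0 <= Int a b f.
Proof. by move=> f0; apply: Rintegral_ge0 => t /=; rewrite in_itv/= => /f0. Qed.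

Lemma Int_cst {R : realType} (a b k : R) : a <= b -> Int a b (fun=> k) = k * (b - a).
Proof.
move=> ab; rewrite /Int Rintegral_cst//; congr (_ * _).
rewrite [X in fine X](lebesgue_measure_itv `[a, b])/= lte_fin.
by move: ab; rewrite le_eqVlt => /predU1P[->|->//]; rewrite ltxx subrr.
Qed.

Lemma Int_set1 {R : realType} (a : R) (f : R -> R) : Int a a f = 0.
Proof. by rewrite /Int set_itv1 Rintegral_set1. Qed.

Lemma Int_chasles {R : realType} (a b s t : R) (f : R -> R) : bmeas a b f ->
  a <= s -> s <= t -> t <= b -> Int a t f - Int a s f = Int s t f.
Proof.
move=> bf a_s st tb.
have bt : bmeas a t f by exact: bmeas_sub bf.
rewrite /Int Rintegral_itvB ?bnd_simp//; last exact: bmeas_integrable.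
apply: Rintegral_itv_obnd_cbnd.
apply: (integrableS _ _ _ (bmeas_integrable bt)) => //.
by apply: subset_itvr; rewrite bnd_simp.
Qed.

Lemma Int_lipschitz {R : realType} (a b K s t : R) (f : R -> R) : bmeas a b f ->
  a <= s -> s <= t -> t <= b -> (forall r, s <= r <= t -> `|f r| <= K) ->
  `|Int a t f - Int a s f| <= K * (t - s).
Proof.
move=> bf a_s st tb fK; rewrite (Int_chasles bf)//.
have bst : bmeas s t f by exact: bmeas_sub bf.
rewrite ler_norml -mulNr -!Int_cst//; apply/andP; split.
  by apply: le_Int => // [|r /fK]; [exact: bmeas_cst|rewrite ler_norml => /andP[]].
by apply: le_Int => // [|r /fK]; [exact: bmeas_cst|rewrite ler_norml => /andP[]].
Qed.

(** * Absolutely continuous functions with bounded derivative *)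

(** The derivative is carried as data, in the integral form used by [admissible]: a control is then
    literally the derivative of a coordinate, and no almost-everywhere differentiation is
    involved. *)
Definition ac {R : realType} (a b : R) (f f' : R -> R) : Prop :=
  bmeas a b f' /\ forall t, a <= t <= b -> f t = f a + Int a t f'.

Lemma eq_ac {R : realType} (a b : R) (f g f' g' : R -> R) : a <= b ->
  (forall t, a <= t <= b -> f t = g t) ->
  (forall t, a <= t <= b -> f' t = g' t) -> ac a b f f' -> ac a b g g'.
Proof.
move=> ab fg fg' [bf ff]; split; first exact: eq_bmeas bf.
move=> t /[dup] tab /andP[at_ tb]; rewrite -!fg ?lexx// ff//.
by congr (_ + _); apply: eq_Int => r /andP[ar rt]; rewrite fg'// ar (le_trans rt).
Qed.

Lemma ac_Int {R : realType} (a b : R) (f f' : R -> R) : a <= b ->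
  ac a b f f' -> Int a b f' = f b - f a.
Proof. by move=> ab [_ /(_ b)]; rewrite ab lexx => ->//; rewrite addrC addKr. Qed.

Lemma ac_incr {R : realType} (a b s t : R) (f f' : R -> R) : ac a b f f' ->
  a <= s -> s <= t -> t <= b -> f t - f s = Int s t f'.
Proof.
move=> [bf ff] a_s st tb; rewrite -(Int_chasles bf)//.
rewrite (ff t) ?(le_trans a_s)// (ff s) ?a_s ?(le_trans st)//; lra.
Qed.

Lemma ac_lipschitz {R : realType} (a b : R) (f f' : R -> R) : ac a b f f' ->
  exists2 M, 0 <= M & forall s t, a <= s <= b -> a <= t <= b ->
  `|f t - f s| <= M * `|t - s|.
Proof.
move=> [bf ff]; have [_ [M fM]] := bf; exists `|M| => // s t.
have fM' r : a <= r <= b -> `|f' r| <= `|M|.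
  by move=> /fM /le_trans; apply; exact: ler_norm.
wlog st : s t / s <= t => [hw|] sab tab.
  have [|/ltW] := leP s t => [st|ts]; first exact: hw.
  by rewrite distrC [X in _ * X]distrC; apply: hw.
have /andP[a_s _] := sab; have /andP[_ tb] := tab.
rewrite (ff s)// (ff t)// opprD addrACA subrr add0r.
rewrite (ger0_norm (_ : 0 <= t - s)) ?subr_ge0//.
apply: (Int_lipschitz bf) => // r /andP[sr rt]; apply: fM'.
by rewrite (le_trans a_s)//= (le_trans rt).
Qed.

(** Precomposition with this retraction onto [a, b] extends a function from [a, b] to the whole
    line, so that results about globally continuous or differentiable functions apply. *)
Definition clamp {R : realType} (a b t : R) : R := Num.max a (Num.min b t).

Lemma clamp_id {R : realType} (a b t : R) : a <= t <= b -> clamp a b t = t.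
Proof. by move=> /andP[a_t tb]; rewrite /clamp min_r// max_r. Qed.

Lemma clamp_in {R : realType} (a b t : R) : a <= b -> a <= clamp a b t <= b.
Proof. by move=> ab; rewrite /clamp le_max lexx/= ge_max ab ge_min lexx. Qed.

Lemma clamp_nonexpansive {R : realType} (a b s t : R) : a <= b ->
  `|clamp a b t - clamp a b s| <= `|t - s|.
Proof.
move=> ab; wlog st : s t / s <= t => [hw|].
  have [|/ltW] := leP s t => [st|ts]; first exact: hw.
  by rewrite distrC [X in _ <= X]distrC; apply: hw.
rewrite (ger0_norm (_ : 0 <= t - s)) ?subr_ge0//.
by rewrite /clamp /Num.max /Num.min; do ![case: ifPn]; rewrite -?leNgt => *;
  rewrite ler_norml; apply/andP; split; lra.
Qed.

Lemma near_dist {R : realType} (t e : R) : 0 < e -> \forall s \near t, `|s - t| < e.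
Proof.
move=> e0; have /cvgrPdist_lt/(_ e e0) : (id : R -> R) x @[x --> t] --> t by exact: cvg_id.
by apply: filterS => s; rewrite distrC.
Qed.

Lemma ac_clamp_continuous {R : realType} (a b : R) (f f' : R -> R) :
  a <= b -> ac a b f f' -> continuous (f \o clamp a b).
Proof.
move=> ab /ac_lipschitz[M M0 fM] t; apply/cvgrPdist_lt => e e0.
have M1 : 0 < M + 1 by lra.
have := near_dist t (divr_gt0 e0 M1); apply: filterS => s sd.
rewrite distrC /=; apply: le_lt_trans (fM _ _ (clamp_in t ab) (clamp_in s ab)) _.
have := clamp_nonexpansive t s ab; set c := `|_ - clamp _ _ _|; move=> cs.
move: sd; rewrite ltr_pdivlMr// => sd.
have : M * c <= M * `|s - t| by exact: ler_wpM2l.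
have : 0 <= `|s - t| by [].
nra.
Qed.

Lemma ac_bmeas {R : realType} (a b : R) (f f' : R -> R) :
  a <= b -> ac a b f f' -> bmeas a b f.
Proof.
move=> ab acf; apply: (@eq_bmeas _ _ _ (f \o clamp a b)).
  by move=> t tab /=; rewrite clamp_id.
apply: (bmeas_continuous (phi := f \o clamp a b) (f := id)).
  exact: (ac_clamp_continuous ab acf).
split; first exact: measurable_id.
exists (`|a| + `|b|) => t /andP[a_t tb]; rewrite ler_norml.
have := ler_norm b; have := ler_norm (- a); rewrite normrN.
by have := normr_ge0 a; have := normr_ge0 b; lra.
Qed.

Lemma ac_within_continuous {R : realType} (a b : R) (f f' : R -> R) :
  a <= b -> ac a b f f' -> {within `[a, b], continuous f}.
Proof.
move=> ab acf; apply: (@subspace_eq_continuous _ _ _ (f \o clamp a b)).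
  by move=> t; rewrite inE/= in_itv/= => /clamp_id ->.
by apply: continuous_subspaceT; exact: (ac_clamp_continuous ab acf).
Qed.

(** After clamping, [h] has derivative zero at every real point, the end points included, because
    the clamp does not increase distances. *)
Lemma flat_cst {R : realType} (a b : R) (h : R -> R) :
  (forall t e, a <= t <= b -> 0 < e ->
    \forall s \near t, a <= s <= b -> `|h s - h t| <= e * `|s - t|) ->
  forall t, a <= t <= b -> h t = h a.
Proof.
move=> flat t tab; have ab : a <= b by case/andP: tab => /le_trans; exact.
have -> : h t = (h \o clamp a b) t by rewrite /= clamp_id.
have -> : h a = (h \o clamp a b) a by rewrite /= clamp_id// lexx.
apply: is_derive_0_is_cst => {tab}{}t.
apply/is_derive1_caratheodory.
exists (fun s => (h (clamp a b s) - h (clamp a b t)) / (s - t)); split.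
- move=> s; have [->|st] := eqVneq s t; first by rewrite !subrr mulr0.
  by rewrite divfK// subr_eq0.
- apply/cvgrPdist_le => e e0.
  have H := flat _ _ (clamp_in t ab) e0.
  have cc : clamp a b s @[s --> t] --> clamp a b t.
    apply/cvgrPdist_lt => d d0; have := near_dist t d0; apply: filterS => s.
    by apply: le_lt_trans; rewrite distrC; exact: clamp_nonexpansive.
  have : \forall s \near t, a <= clamp a b s <= b ->
      `|h (clamp a b s) - h (clamp a b t)| <= e * `|clamp a b s - clamp a b t|.
    exact: (cc _ H).
  apply: filterS => s /= /(_ (clamp_in s ab)) hs.
  rewrite /= (subrr (h _)) mul0r sub0r normrN normrM normfV.
  have [->|st] := eqVneq s t; first by rewrite !subrr normr0 mul0r ltW.
  rewrite ler_pdivrMr ?normr_gt0 ?subr_eq0//; apply: le_trans hs _.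
  by rewrite ler_pM2l//; exact: clamp_nonexpansive.
- by rewrite !subrr mul0r.
Qed.

Lemma ac_cst {R : realType} (a b k : R) : ac a b (fun=> k) (fun=> 0).
Proof.
split; first exact: bmeas_cst.
by move=> t /andP[a_t _]; rewrite Int_cst// mul0r addr0.
Qed.

Lemma ac_id {R : realType} (a b : R) : ac a b id (fun=> 1).
Proof.
split; first exact: bmeas_cst.
by move=> t /andP[a_t _]; rewrite Int_cst// mul1r; lra.
Qed.

Lemma acD {R : realType} (a b : R) (f f' g g' : R -> R) :
  ac a b f f' -> ac a b g g' ->
  ac a b (fun t => f t + g t) (fun t => f' t + g' t).
Proof.
move=> [bf ff] [bg gg]; split; first exact: bmeasD.
move=> t /[dup] tab /andP[_ tb].
by rewrite IntD ?(ff t)// ?(gg t)//; [lra| |]; apply: bmeas_sub tb _.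
Qed.

Lemma acZ {R : realType} (a b k : R) (f f' : R -> R) :
  ac a b f f' -> ac a b (fun t => k * f t) (fun t => k * f' t).
Proof.
move=> [bf ff]; split; first exact: bmeasZ.
move=> t /[dup] tab /andP[_ tb].
by rewrite IntZ ?(ff t)// ?mulrDr//; apply: bmeas_sub tb _.
Qed.

Lemma acB {R : realType} (a b : R) (f f' g g' : R -> R) : a <= b ->
  ac a b f f' -> ac a b g g' ->
  ac a b (fun t => f t - g t) (fun t => f' t - g' t).
Proof.
move=> ab acf acg; apply: eq_ac ab _ _ (acD acf (acZ (-1) acg)) => t _;
by rewrite mulN1r.
Qed.

(** The inner function need not be differentiable anywhere in particular, so the difference of the
    two sides is shown to be flat. Its increment from t to s is the Taylor remainder of [phi] at
    f(t) minus the integral of (phi'(f) - phi'(f(t))) f', and both are o(|s - t|). *)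
Lemma ac_comp {R : realType} (a b : R) (phi phi' f f' : R -> R) : a <= b ->
  (forall x : R, is_derive x (1 : R) phi (phi' x)) -> continuous phi' ->
  ac a b f f' -> ac a b (phi \o f) (fun t => phi' (f t) * f' t).
Proof.
move=> ab dphi cphi' acf; have [bf' ff] := acf.
have bf := ac_bmeas ab acf.
have bc : bmeas a b (fun t => phi' (f t) * f' t).
  by apply: bmeasM => //; exact: bmeas_continuous bf.
split=> // t tab.
pose h t := phi (f t) - Int a t (fun t => phi' (f t) * f' t).
suff : h t = h a by rewrite /h Int_set1 /=; lra.
have [M M0 fM] := ac_lipschitz acf; have [_ [N fN]] := bf'.
apply: (flat_cst (a := a) (b := b)) tab => {}t e tab e0.
(* [M] is the Lipschitz constant of [f] and serves the Taylor remainder, [|N|] bounds [f'] and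
   serves the integral, and 1 keeps [K] positive. *)
pose K := M + `|N| + 1.
have K0 : 0 < K by rewrite /K; have := normr_ge0 N; lra.
have e1 : 0 < e / K by exact: divr_gt0.
have cf := ac_clamp_continuous ab acf.
have lin : \forall z \near f t, `|phi z - phi (f t) - phi' (f t) * (z - f t)| <= e / K * `|z - f t|.
  have [g [gE gc g0]] := (is_derive1_caratheodory _ _ _).1 (dphi (f t)).
  move/cvgrPdist_le : gc => /(_ _ e1); apply: filterS => z.
  by rewrite gE -mulrBl normrM distrC g0 => gz; apply: ler_wpM2r.
have := cphi' (f t) => /cvgrPdist_le/(_ _ e1) c'.
have nf (Q : R -> Prop) : (\forall z \near f t, Q z) ->
    exists2 d, 0 < d & forall s, a <= s <= b -> `|s - t| < d -> Q (f s).
  move=> nQ; have : \forall s \near t, Q (f (clamp a b s)).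
    by apply: cf; rewrite /= clamp_id.
  move=> [d /= d0 dQ]; exists d => // s sab std.
  by rewrite -(clamp_id sab); apply: dQ; rewrite /= distrC.
have [d1 d10 h1] := nf _ lin; have [d2 d20 h2] := nf _ c'.
near=> s => sab.
have st1 : `|s - t| < d1 by near: s; exact: near_dist.
have st2 : `|s - t| < d2 by near: s; exact: near_dist.
pose g r := phi' (f r) * f' r - phi' (f t) * f' r.
have bg : bmeas a b g by apply: bmeasB => //; exact: bmeasZ.
have gE r : a <= r <= b -> Int a r g =
    Int a r (fun t => phi' (f t) * f' t) - phi' (f t) * (f r - f a).
  move=> /[dup] rab /andP[_ rb]; rewrite /g IntB ?IntZ; last 3 first.
  - by apply: bmeas_sub bf'.
  - by apply: bmeas_sub bc.
  - by apply: bmeas_sub rb (bmeasZ _ bf').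
  by rewrite (ff r)//; congr (_ - _ * _); lra.
have gi : `|Int a s g - Int a t g| <= e / K * `|N| * `|s - t|.
  have gK r : a <= r <= b -> `|r - t| < d2 -> `|g r| <= e / K * `|N|.
    move=> rab rt; rewrite /g -mulrBl normrM ler_pM//; first by rewrite distrC; exact: h2.
    by rewrite (le_trans (fN _ rab))// ler_norm.
  have /andP[a_s sb] := sab; have /andP[a_t tb] := tab.
  have [st|/ltW ts] := leP s t.
    rewrite distrC (distrC s) (ger0_norm (_ : 0 <= t - s)) ?subr_ge0//.
    apply: (Int_lipschitz bg) => // r /andP[sr rt]; apply: gK.
      by rewrite (le_trans a_s)//= (le_trans rt).
    by apply: le_lt_trans st2; rewrite !ler0_norm; lra.
  rewrite (ger0_norm (_ : 0 <= s - t)) ?subr_ge0//.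
  apply: (Int_lipschitz bg) => // r /andP[tr rs]; apply: gK.
    by rewrite (le_trans a_t)//= (le_trans rs).
  by apply: le_lt_trans st2; rewrite !ger0_norm; lra.
have := h1 _ sab st1; set l := `|_ - _ * _| => hl.
have -> : h s - h t = (phi (f s) - phi (f t) - phi' (f t) * (f s - f t)) -
    (Int a s g - Int a t g).
  by rewrite !gE// /h; lra.
apply: le_trans (ler_normB _ _) _; rewrite -/l.
have := fM _ _ tab sab => fst.
have st0 : 0 <= `|s - t| by [].
have eK0 := ltW e1.
have : e / K * `|f s - f t| <= e / K * (M * `|s - t|) by exact: ler_wpM2l.
have : e * `|s - t| = e / K * (M * `|s - t|) + e / K * `|N| * `|s - t| + e / K * `|s - t|.
  by rewrite -{1}(divfK (lt0r_neq0 K0) e) /K; ring.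
have : 0 <= e / K * `|s - t| by exact: mulr_ge0.
lra.
Unshelve. all: by end_near. Qed.

Lemma ac_sqr {R : realType} (a b : R) (f f' : R -> R) : a <= b ->
  ac a b f f' -> ac a b (fun t => f t ^+ 2) (fun t => 2 * f t * f' t).
Proof.
move=> ab acf; apply: (@ac_comp _ _ _ (fun x => x ^+ 2) (fun x => 2 * x)) => //.
  by move=> x; apply: is_derive_eq; rewrite /GRing.scale/=; ring.
by move=> x; apply: cvgM; [exact: cvg_cst|exact: cvg_id].
Qed.

(** Polarization, 4 f g = (f + g)^2 - (f - g)^2, reduces the product rule to the chain rule for
    squares. *)
Lemma acM {R : realType} (a b : R) (f f' g g' : R -> R) : a <= b ->
  ac a b f f' -> ac a b g g' ->
  ac a b (fun t => f t * g t) (fun t => f' t * g t + f t * g' t).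
Proof.
move=> ab acf acg.
have := acZ 4^-1 (acB ab (ac_sqr ab (acD acf acg)) (ac_sqr ab (acB ab acf acg))).
by apply: eq_ac => // t _; field.
Qed.

Lemma ac_C1 {R : realType} (a b : R) (phi phi' : R -> R) : a <= b ->
  (forall x : R, is_derive x (1 : R) phi (phi' x)) -> continuous phi' -> ac a b phi phi'.
Proof.
move=> ab dphi cphi'; have := ac_comp ab dphi cphi' (ac_id a b).
by apply: eq_ac => // t _; rewrite mulr1.
Qed.

(** * One-variable calculus: explicit derivatives and primitives *)

Lemma derive_continuous {R : realType} (f f' : R -> R) :
  (forall x : R, is_derive x (1 : R) f (f' x)) -> continuous f.
Proof.
move=> df x; apply/differentiable_continuous/derivable1_diffP.
by case: (df x).
Qed.

Lemma sqrtX_continuous {R : realType} n : continuous (fun y : R => Num.sqrt y ^+ n).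
Proof.
move=> y; apply: (@continuous_comp _ _ _ (@Num.sqrt R) (fun x => x ^+ n)).
  exact: sqrt_continuous.
exact: exprn_continuous.
Qed.

Lemma minX_continuous {R : realType} n : continuous (fun y : R => Num.min y 0 ^+ n).
Proof.
move=> y; apply: (@continuous_comp _ _ _ (fun y : R => Num.min y 0) (fun x => x ^+ n)).
  by apply: (@continuous_min R R id (fun=> 0)); [exact: cvg_id|exact: cvg_cst].
exact: exprn_continuous.
Qed.

Lemma is_derive_exprn {R : realType} n (x : R) :
  is_derive x (1 : R) (fun x => x ^+ n.+1) (n.+1%:R * x ^+ n).
Proof.
by split; [exact: exprn_derivable|rewrite exp_derive /GRing.scale/= mulr1].
Qed.

(** The exponent (n+3)/2 exceeds 1, so the power of the positive part is differentiable at 0 too: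
    its difference quotient there is sqrt(z)^(n+1), on both sides of 0. *)
Lemma is_derive_sqrtX {R : realType} n (y : R) :
  is_derive y (1 : R) (fun y => Num.sqrt y ^+ n.+3) (n.+3%:R / 2 * Num.sqrt y ^+ n.+1).
Proof.
have [y0|y0|->] := ltgtP y 0.
- rewrite ler0_sqrtr ?(ltW y0)// expr0n/= mulr0.
  apply: (@near_eq_is_derive _ _ _ (fun=> 0)).
  by apply: filterS (lt_nbhsl y0) => z /ltW z0; rewrite ler0_sqrtr ?expr0n.
- have dy := is_derive1_comp (is_derive_exprn n.+2 (Num.sqrt y)) (is_derive1_sqrt y0).
  apply: (is_derive_eq dy).
  have s0 : Num.sqrt y != 0 by rewrite lt0r_neq0// sqrtr_gt0.
  by rewrite !exprS; field.
- rewrite sqrtr0 expr0n/= mulr0; apply/is_derive1_caratheodory.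
  exists (fun z => Num.sqrt z ^+ n.+1); split.
  + move=> z; rewrite sqrtr0 expr0n/= !subr0; have [z0|z0] := leP 0 z.
      by rewrite -{3}(sqr_sqrtr z0) -exprD addn2.
    by rewrite ler0_sqrtr ?(ltW z0)// !expr0n/= mul0r.
  + exact: sqrtX_continuous.
  + by rewrite sqrtr0 expr0n.
Qed.

Lemma is_derive_minX {R : realType} n (y : R) :
  is_derive y (1 : R) (fun y => Num.min y 0 ^+ n.+2) (n.+2%:R * Num.min y 0 ^+ n.+1).
Proof.
have [y0|y0|->] := ltgtP y 0.
- apply: near_eq_is_derive (is_derive_exprn n.+1 y).
  by apply: filterS (lt_nbhsl y0) => z /ltW z0; rewrite min_l.
- rewrite expr0n/= mulr0.
  apply: (@near_eq_is_derive _ _ _ (fun=> 0)).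
  by apply: filterS (lt_nbhsr y0) => z /ltW z0; rewrite min_r ?expr0n.
- rewrite expr0n/= mulr0; apply/is_derive1_caratheodory.
  exists (fun z => Num.min z 0 ^+ n.+1); split.
  + move=> z; rewrite minxx expr0n/= !subr0; have [z0|z0] := leP 0 z.
      by rewrite !expr0n/= mul0r.
    by rewrite exprSr.
  + exact: minX_continuous.
  + by rewrite minxx expr0n.
Qed.

Lemma one_plus_sqr_gt0 {R : realType} (v : R) : 0 < 1 + v ^+ 2.
Proof. by rewrite ltr_pwDl// sqr_ge0. Qed.

Lemma sqrt1D_gt0 {R : realType} (v : R) : 0 < Num.sqrt (1 + v ^+ 2).
Proof. by rewrite sqrtr_gt0 one_plus_sqr_gt0. Qed.

(** For v = tan theta the function is sin theta, and the derivative is cos^3 theta. *)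
Lemma is_derive_sine_of_slope {R : realType} (v : R) :
  is_derive v (1 : R) (fun v => v / Num.sqrt (1 + v ^+ 2))
    (Num.sqrt (1 + v ^+ 2) ^- 3).
Proof.
have := is_derive1_sqrt (one_plus_sqr_gt0 v) => ds.
have s0 := sqrt1D_gt0 v.
have s2 : Num.sqrt (1 + v ^+ 2) ^+ 2 = 1 + v ^+ 2.
  by rewrite sqr_sqrtr// ltW// one_plus_sqr_gt0.
have dd : is_derive v 1 (fun v => Num.sqrt (1 + v ^+ 2)) (v / Num.sqrt (1 + v ^+ 2)).
  have dq : is_derive v 1 (fun v => 1 + v ^+ 2) (2 * v).
    by apply: is_derive_eq; rewrite /GRing.scale/=; ring.
  apply: (is_derive_eq (@is_derive1_comp _ _ (fun v : R => 1 + v ^+ 2) v _ _ ds dq)).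
  by field; rewrite lt0r_neq0.
have di : is_derive v 1 (fun v => (Num.sqrt (1 + v ^+ 2))^-1)
    (- Num.sqrt (1 + v ^+ 2) ^- 2 *: (v / Num.sqrt (1 + v ^+ 2))).
  by apply: is_deriveV => //; rewrite lt0r_neq0.
have dm := is_deriveM (is_derive_id v (1 : R)) di.
apply: (is_derive_eq dm).
rewrite /GRing.scale/=; set s := Num.sqrt _ in s0 s2 *.
transitivity ((s ^+ 2 - v ^+ 2) / s ^+ 3); first by field; rewrite lt0r_neq0.
by rewrite s2 addrK mul1r.
Qed.

Lemma is_derive_atanZ {R : realType} (c k y : R) :
  is_derive y (1 : R) (fun y => c * atan (y / k)) (c * (k^-1 / (1 + (y / k) ^+ 2))).
Proof.
have dq : is_derive y 1 (fun y => y / k) k^-1.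
  by apply: is_derive_eq; rewrite /GRing.scale/=; ring.
have da := @is_derive1_comp _ _ (fun y : R => y / k) y _ _ (is_derive1_atan (y / k)) dq.
have dc := is_deriveZ c da.
by apply: (is_derive_eq dc); rewrite /GRing.scale/= (mulrC k^-1).
Qed.

Lemma continuous_primitive {R : realType} (f : R -> R) : continuous f ->
  exists F : R -> R, forall x : R, is_derive x (1 : R) F (f x).
Proof.
move=> cf.
have bf a b : bmeas a b f.
  have : bmeas a b (f \o id).
    apply: bmeas_continuous => //; split; first exact: measurable_id.
    exists (`|a| + `|b|) => t /andP[a_t tb]; rewrite ler_norml.
    have := ler_norm b; have := ler_norm (- a); rewrite normrN.
    by have := normr_ge0 a; have := normr_ge0 b; lra.
  by [].
(* The integral over [a, x] is meaningful only for a <= x. The base point therefore moves with [x],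
   to the left of both [x] and 0, and cancels in the difference. *)
pose F x := Int (- (`|x| + 1)) x f - Int (- (`|x| + 1)) 0 f.
(* The single base point [- N] serves all z within distance 1 of [x], since then |z| + 1 <= |x| +
   2. *)
exists F => x; pose N := `|x| + 3.
have FE z : `|z| + 1 <= N -> F z = Int (- N) z f - Int (- N) 0 f.
  move=> zN; rewrite /F.
  have z0 := normr_ge0 z; have := ler_norm (- z); rewrite normrN => zz.
  have zz' := ler_norm z.
  rewrite -(@Int_chasles _ (- N) (z + N) (- (`|z| + 1)) z f)//; try lra.
  by rewrite -(@Int_chasles _ (- N) (z + N) (- (`|z| + 1)) 0 f)//; lra.
have x0 := normr_ge0 x; have := ler_norm (- x); rewrite normrN => xx.
have xx' := ler_norm x.
have [dI Ix] := @continuous_FTC1_closed R f (- N) x N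
  ltac:(rewrite /N; lra) (bmeas_integrable (bf _ _)) ltac:(rewrite /N; lra) (cf x).
apply: (@near_eq_is_derive _ _ _ (fun z => Int (- N) z f - Int (- N) 0 f)).
  have := near_dist x (ltr01 : (0 : R) < 1); apply: filterS => z zx.
  rewrite FE// /N; have := ler_normD (z - x) x; rewrite subrK; lra.
have dI' : is_derive x 1 (fun z => Int (- N) z f) (f x).
  by split; [exact: dI|rewrite -derive1E].
by apply: is_derive_eq; rewrite subr0.
Qed.

(** * Pointwise estimates *)

Lemma sqr_le_norm {R : realDomainType} (a c : R) : 0 <= c -> a ^+ 2 <= c ^+ 2 -> `|a| <= c.
Proof.
move=> c0 ac; rewrite -(@ler_pXn2r _ 2%N) ?nnegrE//.
by rewrite real_normK// num_real.
Qed.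

(** The first bound is the Cauchy-Schwarz inequality. The next two follow from (8/10) n <= u2 + e,
    which holds because s <= 1/10 forces 1 - t <= 1/10, so that s u1 and (1 - t) u2 are each at most
    n/10 in size. *)
Lemma calibration_bounds {R : realFieldType} (s t u1 u2 n : R) :
  0 <= s -> s <= 10^-1 -> 0 <= t -> s ^+ 2 + t ^+ 2 = 1 ->
  0 <= n -> n ^+ 2 = u1 ^+ 2 + u2 ^+ 2 ->
  let e := n - s * u1 - t * u2 in
  [/\ 0 <= e, n <= 2 * u2 + 2 * e, - u2 <= e & `|u2| <= n].
Proof.
move=> s0 s1 t0 st n0 nE e.
have u1n : `|u1| <= n by apply: sqr_le_norm => //; rewrite nE; nra.
have u2n : `|u2| <= n by apply: sqr_le_norm => //; rewrite nE; nra.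
have e0 : `|s * u1 + t * u2| <= n.
  apply: sqr_le_norm => //; rewrite -[n ^+ 2]mul1r -st nE.
  have := sqr_ge0 (s * u2 - t * u1); nra.
have t9 : 9 / 10 <= t by nra.
have t1 : t <= 1 by nra.
move: e0 (u1n) (u2n); rewrite !ler_norml => /andP[e1 e2] /andP[p1 p2] /andP[r1 r2].
have su : s * u1 <= 10^-1 * n by nra.
have tu : (1 - t) * u2 <= 10^-1 * n by nra.
have tu' : - ((1 - t) * u2) <= 10^-1 * n by nra.
by split=> //; rewrite /e; lra.
Qed.

Definition excess {R : realType} (b : nat) (x y : R) : R :=
  (x ^+ 2 - y ^+ b) ^+ 2 - Num.min y 0 ^+ (2 * b).

Definition excess_x {R : realType} (b : nat) (x y : R) : R := 4 * x * (x ^+ 2 - y ^+ b).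

Definition excess_y {R : realType} (b : nat) (x y : R) : R :=
  - (2 * b%:R * y ^+ b.-1 * (x ^+ 2 - y ^+ b))
  - (2 * b)%:R * Num.min y 0 ^+ (2 * b).-1.

(** For y <= 0 the oddness of b gives -y^b >= 0, hence x^2 - y^b >= -y^b >= 0. *)
Lemma excess_ge0 {R : realType} (b : nat) (x y : R) : odd b -> 0 <= excess b x y.
Proof.
move=> ob; rewrite /excess; have [y0|y0] := leP y 0; last first.
  by rewrite expr0n muln_eq0/= -[b == 0]negbK -lt0n odd_gt0//= subr0 sqr_ge0.
have z0 : 0 <= - y ^+ b by rewrite oppr_ge0 exprn_odd_le0.
rewrite mulnC exprM; have := sqr_ge0 x; nra.
Qed.

(** Each partial derivative is at most sqrt(E)/4, stated without roots. For y > 0 one has E = P^2,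
    with gradient 2 P grad P and grad P small on the box. For y <= 0 the power y^(2b) cancels: E =
    x^2 (x^2 - 2 y^b) and E_y = -2 b y^(b-1) x^2, to be compared with E >= x^4. *)
Lemma excess_gradient {R : realType} (b : nat) (delta x y : R) :
  odd b -> (5 <= b)%N -> b%:R * delta <= 100^-1 -> `|x| <= delta -> `|y| <= delta ->
  16 * excess_x b x y ^+ 2 <= excess b x y /\ 16 * excess_y b x y ^+ 2 <= excess b x y.
Proof.
move=> ob b5 bd xd yd.
have d0 : 0 <= delta := le_trans (normr_ge0 x) xd.
have b5R : 5 <= b%:R :> R by rewrite ler_nat.
have d1 : delta <= 500^-1 by nra.
have yk k : (0 < k)%N -> `|y ^+ k| <= delta.
  case: k => // k _; rewrite normrX exprS.
  have : `|y| ^+ k <= 1 by rewrite exprn_ile1//; lra.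
  by have := normr_ge0 y; have := exprn_ge0 k (normr_ge0 y); nra.
have x2 : x ^+ 2 <= delta * 500^-1.
  by rewrite -real_normK ?num_real//; have := normr_ge0 x; nra.
rewrite /excess_x /excess_y /excess.
have pd : `|y ^+ b.-1| <= delta by apply: yk; rewrite ltn_predRL; exact: leq_trans b5.
set p := y ^+ b.-1 in pd *.
have bp : `|b%:R * p| <= 100^-1.
  by rewrite normrM ger0_norm//; have := normr_ge0 p; nra.
have bp2 : (b%:R * p) ^+ 2 <= 100^-1.
  by rewrite -real_normK ?num_real//; have := normr_ge0 (b%:R * p); nra.
have b0 : (0 < b)%N by exact: odd_gt0.
have [y0|y0] := leP y 0; last first.
  have -> : (0 : R) ^+ (2 * b) = 0 by rewrite expr0n muln_eq0/= eqn0Ngt b0.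
  have -> : (0 : R) ^+ (2 * b).-1 = 0 by rewrite expr0n; case: (b) b0 => // c; rewrite mulnS.
  set P := x ^+ 2 - _.
  have P2 := sqr_ge0 P; rewrite !subr0 mulr0 subr0; split.
    rewrite (_ : 16 * _ = P ^+ 2 * (256 * x ^+ 2)); last by ring.
    by rewrite -[leRHS]mulr1; apply: ler_wpM2l => //; lra.
  rewrite (_ : 16 * _ = P ^+ 2 * (64 * (b%:R * p) ^+ 2)); last by ring.
  by rewrite -[leRHS]mulr1; apply: ler_wpM2l => //; lra.
have := yk b b0; rewrite ler_norml => /andP[zd _].
have z0 : y ^+ b <= 0 by rewrite exprn_odd_le0.
have -> : y ^+ (2 * b) = (y ^+ b) ^+ 2 by rewrite mulnC exprM.
have -> : y ^+ (2 * b).-1 = p * y ^+ b.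
  by rewrite -exprD; congr (_ ^+ _); case: (b) b0 => // c _; rewrite mul2n -addnn addSn.
rewrite natrM; set z := y ^+ b in z0 zd *.
have -> : (x ^+ 2 - z) ^+ 2 - z ^+ 2 = x ^+ 2 * (x ^+ 2 - 2 * z) by ring.
split.
  rewrite (_ : 16 * _ = x ^+ 2 * (256 * (x ^+ 2 - z) ^+ 2)); last by ring.
  apply: ler_wpM2l; first exact: sqr_ge0.
  by have := sqr_ge0 x; nra.
rewrite (_ : 16 * _ = x ^+ 4 * (64 * (b%:R * p) ^+ 2)); last by ring.
rewrite (_ : x ^+ 2 * _ = x ^+ 4 + x ^+ 2 * (- 2 * z)); last by ring.
apply: (@le_trans _ _ (x ^+ 4)).
  rewrite -[leRHS]mulr1; apply: ler_wpM2l; last by lra.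
  by rewrite (exprM x 2 2) sqr_ge0.
by rewrite lerDl mulr_ge0 ?sqr_ge0//; lra.
Qed.

(* Below the scale y = 16 A k the smallness of a suffices; above it, the
   inequality of arithmetic and geometric means does. *)
Lemma absorb_gain {R : realFieldType} (A a d k w y r : R) :
  1 <= A -> 0 < k -> 0 <= d -> 0 <= w -> 0 < y -> 0 <= a ->
  a <= (32 * (1 + 256 * A ^+ 2))^-1 -> a * y ^+ 2 <= A * w ->
  d ^+ 4 <= r -> 4 * (d * w) ^+ 2 <= r ->
  d * a <= r / (64 * k ^+ 6) + k ^+ 4 / (32 * (k ^+ 2 + y ^+ 2)).
Proof.
move=> A1 k0 d0 w0 y0 a0 aA ay rd rdw.
have A2 : 1 <= A ^+ 2 by nra.
have k20 : 0 < k ^+ 2 by exact: exprn_gt0.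
have k60 : 0 < 64 * k ^+ 6 by rewrite mulr_gt0// exprn_gt0.
have y20 : 0 < y ^+ 2 by exact: exprn_gt0.
have ky0 : 0 < 32 * (k ^+ 2 + y ^+ 2) by lra.
have r0 : 0 <= r / (64 * k ^+ 6).
  by rewrite divr_ge0 ?(ltW k60)//; apply: le_trans rd; rewrite (exprM d 2 2) sqr_ge0.
have g0 : 0 <= k ^+ 4 / (32 * (k ^+ 2 + y ^+ 2)).
  by rewrite divr_ge0 ?(ltW ky0)// (exprM k 2 2) sqr_ge0.
have aA1 : a * (32 * (1 + 256 * A ^+ 2)) <= 1 by rewrite -ler_pdivlMr ?div1r//; lra.
(* For a deviation d >= k^2 the quartic bound suffices at every height: d^3 >= k^6 and 64 a <= 1. *)
have [dk|kd] := leP (k ^+ 2) d.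
  apply: (@le_trans _ _ (r / (64 * k ^+ 6))); last by lra.
  rewrite ler_pdivlMr//; apply: le_trans rd.
  have d3 : k ^+ 6 <= d ^+ 3.
    by rewrite (exprM k 2 3); rewrite ler_pXn2r// nnegrE ltW.
  have a64 : 64 * a <= 1.
    have : 0 <= a * (A ^+ 2 - 1) by rewrite mulr_ge0// subr_ge0.
    lra.
  rewrite (_ : d ^+ 4 = d * d ^+ 3); last by rewrite exprS.
  rewrite -mulrA; apply: ler_wpM2l => //.
  apply: le_trans d3; rewrite mulrA -[leRHS]mul1r; apply: ler_wpM2r; last by lra.
  by rewrite exprn_ge0// ltW.
have [yk|ky] := ltP y (16 * A * k).
  apply: (@le_trans _ _ (k ^+ 4 / (32 * (k ^+ 2 + y ^+ 2)))); last by lra.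
  rewrite ler_pdivlMr//.
  have Ak : 32 * (k ^+ 2 + y ^+ 2) <= 32 * (1 + 256 * A ^+ 2) * k ^+ 2.
    have : y ^+ 2 <= (16 * A * k) ^+ 2 by rewrite ler_pXn2r// ?nnegrE ltW// (lt_trans y0).
    by lra.
  apply: (@le_trans _ _ (d * a * (32 * (1 + 256 * A ^+ 2) * k ^+ 2))).
    by apply: ler_wpM2l => //; exact: mulr_ge0.
  rewrite (_ : _ * _ = d * k ^+ 2 * (a * (32 * (1 + 256 * A ^+ 2)))); last by ring.
  apply: (@le_trans _ _ (d * k ^+ 2)); last by rewrite (exprM k 2 2) expr2; nra.
  by rewrite -[leRHS]mulr1; apply: ler_wpM2l => //; nra.
have [k3 y2] : k ^+ 3 != 0 /\ y ^+ 2 != 0 by rewrite !lt0r_neq0// exprn_gt0.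
apply: (@le_trans _ _ (A * (d * w) / y ^+ 2)).
  by rewrite ler_pdivlMr// -mulrA [leRHS]mulrCA; apply: ler_wpM2l.
apply: (@le_trans _ _ (4 * (d * w) ^+ 2 / (64 * k ^+ 6) + 4 * A ^+ 2 * k ^+ 6 / y ^+ 4)).
  rewrite -subr_ge0 (_ : _ - _ = (d * w / (4 * k ^+ 3) - 2 * A * k ^+ 3 / y ^+ 2) ^+ 2).
    exact: sqr_ge0.
  by field; rewrite !lt0r_neq0.
apply: lerD; first by rewrite ler_pM2r ?invr_gt0.
have y40 : 0 < y ^+ 4 by exact: exprn_gt0.
rewrite ler_pdivrMr// [leRHS]mulrAC ler_pdivlMr//.
(* The factor 16 in the threshold is chosen for this: after k^2 + y^2 <= 2 y^2, the tail to be
   dominated requires 256 A^2 k^2 <= y^2. *)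
have Aky : 256 * A ^+ 2 * k ^+ 2 <= y ^+ 2.
  have : (16 * A * k) ^+ 2 <= y ^+ 2 by rewrite ler_pXn2r// ?nnegrE ?mulr_ge0// ltW//; lra.
  by lra.
have kky : k ^+ 2 <= y ^+ 2.
  have : 0 <= (A ^+ 2 - 1) * k ^+ 2 by apply: mulr_ge0; lra.
  by lra.
rewrite [leLHS](_ : _ = k ^+ 4 * (128 * A ^+ 2 * k ^+ 2 * (k ^+ 2 + y ^+ 2))); last by ring.
apply: ler_wpM2l; first by rewrite exprn_ge0// ltW.
apply: (@le_trans _ _ (256 * A ^+ 2 * k ^+ 2 * y ^+ 2)); last first.
  by rewrite (exprM y 2 2) [leRHS]expr2; apply: ler_wpM2r; first exact: ltW.
have : 0 <= A ^+ 2 * k ^+ 2 * (y ^+ 2 - k ^+ 2).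
  by apply: mulr_ge0; [rewrite mulr_ge0// sqr_ge0|rewrite subr_ge0].
by lra.
Qed.

(** * Lower bound for the length *)

Lemma Int_le_sub {R : realType} (a c t : R) (f : R -> R) : bmeas a c f ->
  a <= t <= c -> (forall r, a <= r <= c -> 0 <= f r) -> Int a t f <= Int a c f.
Proof.
move=> bf /andP[a_t tc] f0; rewrite -subr_ge0 (Int_chasles bf)//.
by apply: Int_ge0 => r /andP[tr rc]; apply: f0; rewrite (le_trans a_t).
Qed.

Lemma ac_norm_le {R : realType} (a c t : R) (f f' n : R -> R) : ac a c f f' ->
  bmeas a c n -> a <= t <= c -> (forall r, a <= r <= c -> `|f' r| <= n r) ->
  `|f t - f a| <= Int a c n.
Proof.
move=> [bf' ff] bn tac fn; have /andP[a_t tc] := tac.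
have n0 r : a <= r <= c -> 0 <= n r by move=> /fn; apply: le_trans.
rewrite (ff t)// addrC addKr; apply: le_trans (Int_le_sub bn tac n0).
have bt : bmeas a t f' by apply: bmeas_sub bf'.
have bnt : bmeas a t n by apply: bmeas_sub bn.
have sub r : a <= r <= t -> a <= r <= c by move=> /andP[-> /le_trans ->].
rewrite ler_norml -mulN1r -IntZ//; apply/andP; split.
  apply: le_Int => // [|r /sub/fn]; first exact: bmeasZ.
  by rewrite ler_norml mulN1r => /andP[].
by apply: le_Int => // r /sub/fn; rewrite ler_norml => /andP[].
Qed.

(** Write m for the square root of max E, kap for int e and J for the integral to bound. Two
    inequalities close on each other: J <= 2 m^2 kap, as int E y' = 0 leaves only the deficit, and
    m^3 <= J for m > 0, by growth from E(a) = 0. They give m <= 2 kap, and then J <= 8 kap^3. *)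
Lemma excess_integral_bound {R : realType} (a c : R) (E E' n e y' : R -> R) :
  a <= c -> ac a c E E' -> bmeas a c n -> bmeas a c e -> bmeas a c y' ->
  E a = 0 ->
  (forall t, a <= t <= c -> 0 <= E t) ->
  (forall t, a <= t <= c -> 0 <= n t) ->
  (forall t, a <= t <= c -> 0 <= e t) ->
  (forall t, a <= t <= c -> n t <= 2 * y' t + 2 * e t) ->
  (forall t, a <= t <= c -> E' t <= 2^-1 * Num.sqrt (E t) * n t) ->
  Int a c (fun t => E t * y' t) = 0 ->
  Int a c (fun t => E t * n t) <= 8 * Int a c e ^+ 3.
Proof.
move=> ac_ acE bn be by' Ea E0 n0 e0 nE E'E Ey.
have bE := ac_bmeas ac_ acE.
have cE : {within `[a, c], continuous E} by exact: ac_within_continuous acE.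
have [s] := EVT_max ac_ cE; rewrite in_itv/= => sac Es.
have {}Es t : a <= t <= c -> E t <= E s by move=> tac; apply: Es; rewrite in_itv.
set m := Num.sqrt (E s); have m0 : 0 <= m by exact: sqrtr_ge0.
have m2 : m ^+ 2 = E s by rewrite sqr_sqrtr// E0.
set J := Int _ _ _; set kap := Int a c e.
have kap0 : 0 <= kap by exact: Int_ge0.
have bEn : bmeas a c (fun t => E t * n t) by exact: bmeasM.
have J0 : 0 <= J by apply: Int_ge0 => t tac; rewrite mulr_ge0 ?E0 ?n0.
have Jk : J <= 2 * m ^+ 2 * kap.
  have bEy : bmeas a c (fun t => E t * y' t) by exact: bmeasM.
  have bEe : bmeas a c (fun t => m ^+ 2 * e t) by exact: bmeasZ.
  apply: (@le_trans _ _ (Int a c (fun t => 2 * (E t * y' t) + 2 * (m ^+ 2 * e t)))).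
    apply: le_Int => // [|t tac]; first by apply: bmeasD; exact: bmeasZ.
    have : E t * n t <= E t * (2 * y' t + 2 * e t) by rewrite ler_wpM2l ?E0 ?nE.
    have : E t * e t <= m ^+ 2 * e t by rewrite ler_wpM2r ?e0// m2 Es.
    by lra.
  rewrite (IntD (bmeasZ 2 bEy) (bmeasZ 2 bEe)) (IntZ _ bEy) (IntZ _ bEe) (IntZ _ be).
  by rewrite Ey mulr0 add0r mulrA.
have mJ : m ^+ 4 <= m * J.
  have /andP[a_s sc] := sac.
  (* Differentiating E^2 avoids the root at zeros of E and produces the integrand E n: (E^2)' = 2 E
     E' <= sqrt(E) E n <= m E n. *)
  have acE2 := ac_sqr ac_ acE.
  rewrite (exprM m 2 2) m2.
  have -> : E s ^+ 2 = Int a s (fun t => 2 * E t * E' t).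
    rewrite -(ac_incr acE2 (lexx a) a_s sc) Ea expr0n/= subr0 //.
  apply: (@le_trans _ _ (Int a s (fun t => m * (E t * n t)))).
    apply: le_Int.
    - by apply: bmeas_sub acE2.1.
    - by apply: bmeas_sub (bmeasZ _ bEn).
    move=> t /andP[a_t ts]; have tac : a <= t <= c by rewrite a_t (le_trans ts).
    have Em : Num.sqrt (E t) <= m by rewrite ler_wsqrtr ?Es.
    have : E t * E' t <= E t * (2^-1 * Num.sqrt (E t) * n t).
      by rewrite ler_wpM2l ?E0 ?E'E.
    have : Num.sqrt (E t) * (E t * n t) <= m * (E t * n t).
      by rewrite ler_wpM2r ?mulr_ge0 ?E0 ?n0.
    by lra.
  rewrite IntZ; last by apply: bmeas_sub bEn.
  apply: ler_wpM2l => //; apply: Int_le_sub => // t tac.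
  by rewrite mulr_ge0 ?E0 ?n0.
have k3 : 0 <= kap ^+ 3 by exact: exprn_ge0.
have [m_eq0|m_neq0] := eqVneq m 0.
  by move: Jk; rewrite m_eq0 expr0n/= mulr0 mul0r => /le_trans; apply; lra.
have m_gt0 : 0 < m by rewrite lt0r m_neq0.
have mk : m <= 2 * kap.
  have m3 : 0 < m ^+ 3 by exact: exprn_gt0.
  rewrite -(ler_pM2l m3) -exprSr; apply: le_trans mJ _.
  have : m * J <= m * (2 * m ^+ 2 * kap) by rewrite ler_pM2l.
  by lra.
apply: le_trans Jk _.
have : m ^+ 2 <= (2 * kap) ^+ 2 by rewrite ler_pXn2r ?nnegrE//; lra.
move=> /(ler_wpM2r kap0); lra.
Qed.

Lemma ac_excess {R : realType} (b : nat) (a c : R) (x x' y y' : R -> R) :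
  (0 < b)%N -> a <= c -> ac a c x x' -> ac a c y y' ->
  ac a c (fun t => excess b (x t) (y t))
    (fun t => excess_x b (x t) (y t) * x' t + excess_y b (x t) (y t) * y' t).
Proof.
move=> b0 ac_ acx acy.
have acyb : ac a c (fun t => y t ^+ b) (fun t => b%:R * y t ^+ b.-1 * y' t).
  apply: (@ac_comp _ _ _ (fun y => y ^+ b) (fun y => b%:R * y ^+ b.-1)) => //.
    by case: (b) b0 => // n _ z; exact: is_derive_exprn.
  by move=> z; apply: cvgM; [exact: cvg_cst|exact: exprn_continuous].
have acm : ac a c (fun t => Num.min (y t) 0 ^+ (2 * b))
    (fun t => (2 * b)%:R * Num.min (y t) 0 ^+ (2 * b).-1 * y' t).
  apply: (@ac_comp _ _ _ (fun y => Num.min y 0 ^+ (2 * b))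
    (fun y => (2 * b)%:R * Num.min y 0 ^+ (2 * b).-1)) => //.
    by case: (b) b0 => // n _ z; rewrite mulnS add2n; exact: is_derive_minX.
  by move=> z; apply: cvgM; [exact: cvg_cst|exact: minX_continuous].
have := acB ac_ (ac_sqr ac_ (acB ac_ (ac_sqr ac_ acx) acyb)) acm.
by apply: eq_ac => // t _; rewrite /excess_x /excess_y; ring.
Qed.

(* Num.sqrt y = 0 for y <= 0, so this is the positive part of y to the power b/2. *)
Definition profile {R : realType} (b : nat) (y : R) : R := Num.sqrt y ^+ b.

Definition slope {R : realType} (b : nat) (y : R) : R :=
  b%:R / 2 * Num.sqrt y ^+ b.-2.

(** The second derivative of the profile. As b >= 5, the exponent b - 4 is positive, so it is
    continuous and vanishes for y <= 0. *)
Definition dslope {R : realType} (b : nat) (y : R) : R :=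
  b%:R / 2 * (b.-2%:R / 2 * Num.sqrt y ^+ b.-2.-2).

Definition speed {R : realType} (b : nat) (y : R) : R := Num.sqrt (1 + slope b y ^+ 2).

Definition sine {R : realType} (b : nat) (y : R) : R := slope b y / speed b y.

Lemma speed_gt0 {R : realType} (b : nat) (y : R) : 0 < speed b y.
Proof. exact: sqrt1D_gt0. Qed.

Lemma is_derive_profile {R : realType} (b : nat) (y : R) : (5 <= b)%N ->
  is_derive y (1 : R) (profile b) (slope b y).
Proof. by case: b => [|[|[|b]]]// _; exact: is_derive_sqrtX. Qed.

Lemma is_derive_slope {R : realType} (b : nat) (y : R) : (5 <= b)%N ->
  is_derive y (1 : R) (slope b) (dslope b y).
Proof.
move=> b5; have [m bE] : exists m, b.-2 = m.+3.
  by exists (b - 5)%N; case: b b5 => [|[|[|[|[|b]]]]]//= _; rewrite !subSS subn0.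
rewrite /slope /dslope bE /=; exact: (is_deriveZ (b%:R / 2) (is_derive_sqrtX m y)).
Qed.

Lemma slope_continuous {R : realType} (b : nat) : continuous (@slope R b).
Proof. by move=> y; apply: cvgM; [exact: cvg_cst|exact: sqrtX_continuous]. Qed.

Lemma dslope_continuous {R : realType} (b : nat) : continuous (@dslope R b).
Proof.
move=> y; apply: cvgM; first exact: cvg_cst.
by apply: cvgM; [exact: cvg_cst|exact: sqrtX_continuous].
Qed.

Lemma sqrt1D_continuous {R : realType} : continuous (fun v : R => Num.sqrt (1 + v ^+ 2)).
Proof.
move=> v; have c1 : {for v, continuous (fun v : R => 1 + v ^+ 2)}.
  by apply: cvgD; [exact: cvg_cst|exact: exprn_continuous].
exact: (continuous_comp c1 (@sqrt_continuous R _)).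
Qed.

Lemma speed_continuous {R : realType} (b : nat) : continuous (@speed R b).
Proof.
move=> y; exact: (continuous_comp (@slope_continuous R b y) (@sqrt1D_continuous R _)).
Qed.

Lemma ac_sine {R : realType} (b : nat) (a c : R) (y y' : R -> R) : (5 <= b)%N ->
  a <= c -> ac a c y y' ->
  ac a c (fun t => sine b (y t))
    (fun t => speed b (y t) ^- 3 * (dslope b (y t) * y' t)).
Proof.
move=> b5 ac_ acy.
have acs := ac_comp ac_ (fun z => is_derive_slope z b5) (@dslope_continuous R b) acy.
have c3 : continuous (fun v : R => Num.sqrt (1 + v ^+ 2) ^- 3).
  move=> v; apply: cvgV; first by rewrite lt0r_neq0// exprn_gt0// sqrt1D_gt0.
  exact: (continuous_comp (@sqrt1D_continuous R v) (@exprn_continuous R 3 _)).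
exact: (ac_comp ac_ is_derive_sine_of_slope c3 acs).
Qed.

(* The right-hand side is the threshold of absorb_gain for A = b^2. *)
Definition small {R : realType} (b : nat) (delta : R) : Prop :=
  0 < delta /\ b%:R ^+ 2 * Num.sqrt delta <= (32 * (1 + 256 * (b%:R ^+ 2) ^+ 2))^-1.

Lemma exists_small {R : realType} (b : nat) : exists delta : R, small b delta.
Proof.
pose t : R := (32 * (1 + 256 * (b%:R ^+ 2) ^+ 2))^-1.
have t0 : 0 < t by rewrite invr_gt0; have := sqr_ge0 (b%:R ^+ 2 : R); lra.
have b0 : 0 < 1 + b%:R ^+ 2 :> R by rewrite ltr_pwDl// sqr_ge0.
(* The root of the witness is t / (1 + b^2), and b^2 / (1 + b^2) <= 1. *)
exists ((t / (1 + b%:R ^+ 2)) ^+ 2); split; first by rewrite exprn_gt0// divr_gt0.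
rewrite sqrtr_sqr ger0_norm; last by rewrite ltW// divr_gt0.
rewrite -/t mulrA ler_pdivrMr// mulrC; apply: ler_wpM2l; first exact: ltW.
lra.
Qed.

Lemma inv_threshold_le {R : realFieldType} (X : R) :
  1 <= X -> (32 * (1 + 256 * X))^-1 <= 100^-1.
Proof. by move=> X1; rewrite lef_pV2 ?posrE; lra. Qed.

(** * Smallness of the profile and the pointwise bound on the gain *)

Section small_bounds.
Context {R : realType} (b : nat) (delta : R).
Hypotheses (b5 : (5 <= b)%N) (sd : small b delta).

Let A : R := b%:R ^+ 2.
(** The threshold of [absorb_gain], not the calibration angle. *)
Let theta : R := (32 * (1 + 256 * A ^+ 2))^-1.

Let A25 : 25 <= A.
Proof. by rewrite /A -natrX ler_nat; rewrite (@leq_exp2r 5 b 2). Qed.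

Let theta_lt : theta <= 100^-1.
Proof. by apply: inv_threshold_le; have := A25; nra. Qed.

Let sqrt_delta : Num.sqrt delta <= theta.
Proof.
have := sd.2; rewrite -/A -/theta => h.
have := sqrtr_ge0 delta => s0.
have : 0 <= (A - 1) * Num.sqrt delta by rewrite mulr_ge0//; have := A25; lra.
lra.
Qed.

Let b_le : b%:R <= A.
Proof. by rewrite /A -natrX ler_nat -[X in (X <= _)%N]expn1 leq_pexp2l// (leq_trans _ b5). Qed.

Lemma small_mul : b%:R * delta <= 100^-1.
Proof.
rewrite -(sqr_sqrtr (ltW sd.1)) expr2 mulrA.
have s0 := sqrtr_ge0 delta; have := sqrt_delta; have := theta_lt => t1 s1.
have : b%:R * Num.sqrt delta <= A * Num.sqrt delta by rewrite ler_wpM2r// b_le.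
have := sd.2; rewrite -/A -/theta => h1 h2.
apply: (@le_trans _ _ (theta * Num.sqrt delta)); first by rewrite ler_wpM2r//; lra.
apply: (@le_trans _ _ (1 * Num.sqrt delta)); first by rewrite ler_wpM2r//; lra.
by lra.
Qed.

Lemma small_le : delta <= 100^-1.
Proof.
have := small_mul; have : 1 <= b%:R :> R by rewrite ler1n (leq_trans _ b5).
have := ltW sd.1; nra.
Qed.

Let sqrtX_le y k : (0 < k)%N -> y <= delta -> Num.sqrt y ^+ k <= Num.sqrt delta.
Proof.
case: k => // k _ yd; have s0 := sqrtr_ge0 y; have := ler_wsqrtr yd => sy.
have s1 : Num.sqrt y ^+ k <= 1.
  by rewrite exprn_ile1//; have := sqrt_delta; have := theta_lt; lra.
by rewrite exprS -[leRHS]mulr1; apply: ler_pM => //; exact: exprn_ge0.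
Qed.

Lemma slope_ge0 (y : R) : 0 <= slope b y.
Proof. by rewrite mulr_ge0 ?divr_ge0// exprn_ge0// sqrtr_ge0. Qed.

Lemma dslope_ge0 (y : R) : 0 <= dslope b y.
Proof. by rewrite mulr_ge0 ?divr_ge0// mulr_ge0 ?divr_ge0// exprn_ge0// sqrtr_ge0. Qed.

Lemma slope_small (y : R) : y <= delta -> slope b y <= 10^-1.
Proof.
move=> yd; have k0 : (0 < b.-2)%N by case: (b) b5 => [|[|[|]]].
have := sqrtX_le k0 yd => h.
have h0 : 0 <= Num.sqrt y ^+ b.-2 by rewrite exprn_ge0// sqrtr_ge0.
rewrite /slope; apply: (@le_trans _ _ (A * Num.sqrt delta)).
  by apply: ler_pM => //; rewrite ?divr_ge0//; have := b_le; have := A25; lra.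
by have := sd.2; rewrite -/A -/theta; have := theta_lt; lra.
Qed.

Lemma dslope_small (y : R) : y <= delta -> dslope b y <= theta.
Proof.
move=> yd; have k0 : (0 < b.-2.-2)%N by case: (b) b5 => [|[|[|[|[|]]]]].
have := sqrtX_le k0 yd => h.
have h0 : 0 <= Num.sqrt y ^+ b.-2.-2 by rewrite exprn_ge0// sqrtr_ge0.
have bb : b.-2%:R <= b%:R :> R by rewrite ler_nat (leq_trans (leq_pred _))// leq_pred.
have b0 : 0 <= b.-2%:R :> R by [].
apply: le_trans sd.2; rewrite /dslope mulrA; apply: ler_pM => //.
by rewrite expr2; apply: ler_pM; rewrite ?divr_ge0//; lra.
Qed.

(** For the power w = y^(b/2) one has w'' y^2 = (b/2)(b/2 - 1) w. This supplies the hypothesis a y^2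
    <= A w of [absorb_gain]. *)
Lemma dslope_profile (y : R) : 0 <= y -> dslope b y * y ^+ 2 <= A * profile b y.
Proof.
move=> y0; have -> : profile b y = Num.sqrt y ^+ b.-2.-2 * y ^+ 2.
  rewrite -{3}(sqr_sqrtr y0) -exprM -exprD /profile; congr (_ ^+ _).
  by case: (b) b5 => [|[|[|[|[|n]]]]]//= _; rewrite addn4.
rewrite [leRHS]mulrA; apply: ler_wpM2r; first exact: sqr_ge0.
rewrite /dslope [leLHS]mulrA; apply: ler_wpM2r; first by rewrite exprn_ge0// sqrtr_ge0.
have bb : b.-2%:R <= b%:R :> R by rewrite ler_nat (leq_trans (leq_pred _))// leq_pred.
have b0 : 0 <= b.-2%:R :> R by [].
by rewrite /A expr2; apply: ler_pM; rewrite ?divr_ge0//; lra.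
Qed.

Lemma profile_le (y : R) : y <= delta -> 0 <= profile b y <= 1.
Proof.
move=> yd; rewrite exprn_ge0 ?sqrtr_ge0//=.
have := @sqrtX_le y b (leq_trans _ b5) yd; rewrite /profile => /(_ isT).
by have := sqrt_delta; have := theta_lt; lra.
Qed.

Lemma gain_le (k x y y' n e : R) : odd b ->
  `|x| <= delta -> `|y| <= delta -> 0 < k -> k <= 1 -> 0 <= e ->
  `|y'| <= n -> - y' <= e ->
  (x - profile b y) * (speed b y ^- 3 * (dslope b y * y')) <=
  3 / 8 * e + (64 * k ^+ 6)^-1 * (excess b x y * n)
  + k ^+ 3 / 32 * (k^-1 / (1 + (y / k) ^+ 2)) * y'.
Proof.
move=> ob xd yd k0 k1 e0 yn ye.
have n0 : 0 <= n := le_trans (normr_ge0 _) yn.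
have k20 : 0 < k ^+ 2 by exact: exprn_gt0.
have y20 := sqr_ge0 y.
have -> : k ^+ 3 / 32 * (k^-1 / (1 + (y / k) ^+ 2)) = k ^+ 4 / (32 * (k ^+ 2 + y ^+ 2)).
  by field; rewrite !lt0r_neq0//; lra.
set g := k ^+ 4 / _; set W := (64 * k ^+ 6)^-1; set E := excess b x y.
have E0 : 0 <= E by exact: excess_ge0.
have W0 : 0 <= W by rewrite invr_ge0 mulr_ge0// exprn_ge0// ltW.
have g0 : 0 <= g by rewrite divr_ge0// ?mulr_ge0 ?exprn_ge0// ?ltW//; lra.
have g8 : g <= 8^-1.
  rewrite ler_pdivrMr; last by lra.
  have : k ^+ 2 * k ^+ 2 <= 1 * k ^+ 2 by apply: ler_wpM2r; [exact: ltW|rewrite exprn_ile1// ltW].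
  by rewrite -exprD mul1r; lra.
have [yd1 yd2] : - delta <= y /\ y <= delta by move: yd; rewrite ler_norml => /andP[].
have [xd1 xd2] : - delta <= x /\ x <= delta by move: xd; rewrite ler_norml => /andP[].
have d1 := small_le.
have /andP[w0 w1] := profile_le yd2.
have s1 : 1 <= speed b y.
  by rewrite -{1}(@sqrtr1 R) ler_wsqrtr// lerDl sqr_ge0.
have s3 : 0 <= speed b y ^- 3 <= 1.
  rewrite invr_ge0 exprn_ge0 ?(le_trans _ s1)//= invf_le1 ?exprn_ege1//.
  by rewrite exprn_gt0// (lt_le_trans _ s1).
pose p := speed b y ^- 3 * dslope b y.
have p0 : 0 <= p by rewrite mulr_ge0 ?dslope_ge0//; case/andP: s3.
have pd : p <= dslope b y.
  by rewrite -[leRHS]mul1r ler_wpM2r ?dslope_ge0//; case/andP: s3.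
have pt : p <= theta := le_trans pd (dslope_small yd2).
rewrite [leLHS](_ : _ = (x - profile b y) * p * y'); last by rewrite /p !mulrA.
(* Origin of 3/8: when y moves backwards, the gain is at most (1/4)(-y'), the arctangent term loses
   at most (1/8)(-y'), and -y' <= e. *)
have [y'0|y'0] := leP 0 y'; last first.
  have xw : (x - profile b y) * p >= - 4^-1.
    by have := theta_lt; nra.
  have : 0 <= W * (E * n) by rewrite !mulr_ge0.
  have : (x - profile b y) * p * - y' >= - 4^-1 * - y' by rewrite ler_wpM2r//; lra.
  have : g * - y' <= 8^-1 * - y' by rewrite ler_wpM2r//; lra.
  by lra.
suff : (x - profile b y) * p <= W * E + g.
  move=> h; have : (x - profile b y) * p * y' <= (W * E + g) * y' by rewrite ler_wpM2r.
  have : W * E * y' <= W * E * n.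
    by rewrite ler_wpM2l ?mulr_ge0//; move: yn; rewrite ger0_norm.
  by lra.
have [xw|xw] := leP x (profile b y).
  apply: (@le_trans _ _ 0); last by rewrite addr_ge0// mulr_ge0.
  by rewrite mulr_le0_ge0// subr_le0.
have [y0|y0] := leP y 0.
  have -> : p = 0.
    rewrite /p /dslope ler0_sqrtr// expr0n.
    by case: (b) b5 => [|[|[|[|[|i]]]]]//= _; rewrite !mulr0.
  by rewrite mulr0 addr_ge0// mulr_ge0.
(* Now x > w >= 0, so x + w dominates both x - w and 2 w. This gives the lower bounds d^4 and 4 (d
   w)^2 for E. *)
have EE : E = ((x - profile b y) * (x + profile b y)) ^+ 2.
  rewrite /E /excess min_r ?(ltW y0)// expr0n muln_eq0/= eqn0Ngt odd_gt0//= subr0.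
  rewrite -subr_sqr; congr ((_ - _) ^+ 2).
  by rewrite /profile -exprM mulnC exprM sqr_sqrtr// ltW.
have d0 : 0 <= x - profile b y by rewrite subr_ge0 ltW.
rewrite mulrC -[W * E]mulrC; rewrite [leLHS]mulrC.
apply: (@absorb_gain _ A _ _ k (profile b y)) => //.
- by have := A25; lra.
- apply: le_trans (dslope_profile (ltW y0)); apply: ler_wpM2r => //.
- rewrite EE (exprM _ 2 2) ler_pXn2r ?nnegrE ?sqr_ge0//; last by rewrite mulr_ge0//; lra.
  by rewrite expr2; apply: ler_wpM2l => //; lra.
- rewrite EE (_ : 4 * _ = ((x - profile b y) * (2 * profile b y)) ^+ 2); last by ring.
  rewrite ler_pXn2r ?nnegrE ?mulr_ge0//; [|by lra].
  by apply: ler_wpM2l => //; lra.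
Qed.

End small_bounds.

Lemma ac_minX {R : realType} (m : nat) (a c : R) (y y' : R -> R) :
  a <= c -> ac a c y y' ->
  ac a c (fun t => Num.min (y t) 0 ^+ m.+2)
    (fun t => m.+2%:R * Num.min (y t) 0 ^+ m.+1 * y' t).
Proof.
move=> ac_; apply: (@ac_comp _ _ _ (fun y => Num.min y 0 ^+ m.+2)
    (fun y => m.+2%:R * Num.min y 0 ^+ m.+1)) => //.
  exact: is_derive_minX.
by move=> z; apply: cvgM; [exact: cvg_cst|exact: minX_continuous].
Qed.

(** The form q(y) dy is exact, with primitive min(y, 0)^(2b+1) / (2b+1), whose increment from -r to
    r is the prescribed increment of the third coordinate. *)
Lemma excess_moment {R : realType} (b : nat) (a c r : R) (x x' y y' : R -> R) :
  odd b -> a <= c -> 0 < r -> ac a c x x' -> ac a c y y' ->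
  y a = - r -> y c = r ->
  Int a c (fun t => y' t * (x t ^+ 2 - y t ^+ b) ^+ 2) =
    r ^+ (2 * b + 1) / (2 * b + 1)%:R ->
  Int a c (fun t => excess b (x t) (y t) * y' t) = 0.
Proof.
move=> ob ac_ r0 acx acy ya yc moment.
have b0 : (0 < b)%N by exact: odd_gt0.
have [m mE] : exists m, (2 * b + 1 = m.+2)%N.
  by exists (2 * b).-1; rewrite addn1 prednK// muln_gt0.
have mE' : (2 * b = m.+1)%N by apply: succn_inj; rewrite -mE addn1.
have acm := acZ (m.+2%:R^-1) (ac_minX m ac_ acy).
have bx := ac_bmeas ac_ acx; have by_ := ac_bmeas ac_ acy.
have bP : bmeas a c (fun t => y' t * (x t ^+ 2 - y t ^+ b) ^+ 2).
  apply: bmeasM acy.1 _.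
  have bx2 : bmeas a c (fun t => x t ^+ 2).
    exact: (bmeas_continuous (@exprn_continuous R 2) bx).
  have byb : bmeas a c (fun t => y t ^+ b).
    exact: (bmeas_continuous (@exprn_continuous R b) by_).
  exact: (bmeas_continuous (@exprn_continuous R 2) (bmeasB bx2 byb)).
rewrite (@eq_Int _ _ _ _ (fun t => y' t * (x t ^+ 2 - y t ^+ b) ^+ 2 -
    m.+2%:R^-1 * (m.+2%:R * Num.min (y t) 0 ^+ m.+1 * y' t))); last first.
  move=> t _; rewrite /excess mE' mulrBl [m.+2%:R * _ * _]mulrAC -mulrA mulrA.
  by rewrite -[in m.+2%:R^-1 * _]mulrA mulKf ?pnatr_eq0//; ring.
rewrite (IntB bP acm.1) (ac_Int ac_ acm) moment yc ya mE.
rewrite min_r ?(ltW r0)// expr0n/= mulr0 min_l; last by rewrite oppr_le0 ltW.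
have om : odd m.+2 by rewrite -mE addn1 /= oddM.
rewrite exprNn -signr_odd om expr1; ring.
Qed.

Lemma length_lower_bound {R : realType} (b : nat) (delta r a c : R)
    (Lam x x' y y' n : R -> R) :
  odd b -> (5 <= b)%N -> small b delta -> 0 < r -> 10 * r <= delta ->
  (forall z : R, is_derive z (1 : R) Lam (speed b z)) -> a <= c ->
  ac a c x x' -> ac a c y y' -> bmeas a c n ->
  (forall t, a <= t <= c -> 0 <= n t) ->
  (forall t, a <= t <= c -> n t ^+ 2 = x' t ^+ 2 + y' t ^+ 2) ->
  x a = 0 -> y a = - r -> x c = profile b r -> y c = r ->
  Int a c (fun t => y' t * (x t ^+ 2 - y t ^+ b) ^+ 2) =
    r ^+ (2 * b + 1) / (2 * b + 1)%:R ->
  Lam r - Lam (- r) <= Int a c n.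
Proof.
move=> ob b5 sd r0 rd dLam ac_ acx acy bn n0 nE xa ya xc yc moment.
rewrite leNgt; apply/negP => short.
have d1 := small_le b5 sd.
have ends t : a <= t <= c -> a <= t /\ t <= c by move=> /andP[].
have rr : - r <= r by lra.
have speed2 z : z <= delta -> speed b z <= 2.
  move=> zd; have := slope_small b5 sd zd; have := slope_ge0 b z => s0 s1.
  rewrite -(@ger0_norm _ (2 : R))// -sqrtr_sqr ler_wsqrtr//.
  have : slope b z ^+ 2 <= 10^-1 ^+ 2 by rewrite ler_pXn2r ?nnegrE.
  lra.
(* A competitor shorter than the curve has length below 4 r. Starting at height -r it keeps |x| and
   |y| below 5 r <= delta, so all local bounds apply along it. *)
have Lam4 : Lam r - Lam (- r) <= 4 * r.
  have acL := ac_C1 rr dLam (@speed_continuous R b).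
  rewrite -(ac_Int rr acL).
  apply: (@le_trans _ _ (Int (- r) r (fun=> 2))); last by rewrite Int_cst//; lra.
  apply: le_Int acL.1 (bmeas_cst _ _ _) _ => t /andP[_ tr]; apply: speed2; lra.
have x'n t : a <= t <= c -> `|x' t| <= n t.
  by move=> tac; apply: sqr_le_norm; rewrite ?n0// nE// lerDl sqr_ge0.
have y'n t : a <= t <= c -> `|y' t| <= n t.
  by move=> tac; apply: sqr_le_norm; rewrite ?n0// nE// lerDr sqr_ge0.
have xd t : a <= t <= c -> `|x t| <= delta.
  move=> tac; have := ac_norm_le acx bn tac x'n; rewrite xa subr0; lra.
have yd t : a <= t <= c -> `|y t| <= delta.
  move=> tac; have := ac_norm_le acy bn tac y'n; rewrite ya => h.
  have := ler_normD (y t - - r) (- r); rewrite subrK normrN (gtr0_norm r0); lra.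
have yd' t : a <= t <= c -> y t <= delta.
  by move=> /yd; rewrite ler_norml => /andP[].
have bx := ac_bmeas ac_ acx; have by_ := ac_bmeas ac_ acy.
(* Integration by parts of sine(y) against the horizontal deviation D. *)
pose D t := x t - profile b (y t).
pose D' t := x' t - slope b (y t) * y' t.
pose S t := sine b (y t).
pose S' t := speed b (y t) ^- 3 * (dslope b (y t) * y' t).
have acS : ac a c S S' by exact: ac_sine.
have acD : ac a c D D'.
  apply: (acB ac_ acx); apply: (ac_comp ac_ _ _ acy).
    by move=> z; exact: is_derive_profile.
  exact: slope_continuous.
have acSD := acM ac_ acS acD.
have Da : D a = 0.
  rewrite /D xa ya /profile ler0_sqrtr ?oppr_le0 ?ltW// expr0n.
  by case: (b) b5 => //= i _; rewrite subr0.
have Dc : D c = 0 by rewrite /D xc yc subrr.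
have bSD' : bmeas a c (fun t => S' t * D t) by apply: bmeasM acS.1 (ac_bmeas ac_ acD).
have bSD : bmeas a c (fun t => S t * D' t) by apply: bmeasM (ac_bmeas ac_ acS) acD.1.
set G := Int a c (fun t => S' t * D t).
have GE : Int a c (fun t => S t * D' t) = - G.
  have := ac_Int ac_ acSD; rewrite Da Dc !mulr0 subrr IntD// -/G; lra.
have acLy := ac_comp ac_ dLam (@speed_continuous R b) acy.
pose e t := n t - S t * x' t - (speed b (y t))^-1 * y' t.
(* Substituting x' = D' + slope y' uses tan theta sin theta + cos theta = 1 / cos theta, that is,
   slope^2 / speed + 1 / speed = speed. *)
have eE t : e t = n t - S t * D' t - speed b (y t) * y' t.
  rewrite /e /D' /S /sine.
  have v0 : speed b (y t) != 0 by rewrite lt0r_neq0// speed_gt0.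
  have v2 : speed b (y t) ^+ 2 = 1 + slope b (y t) ^+ 2.
    by rewrite sqr_sqrtr// ltW// one_plus_sqr_gt0.
  suff -> : slope b (y t) / speed b (y t) * (x' t - slope b (y t) * y' t) =
    slope b (y t) / speed b (y t) * x' t - (speed b (y t) - (speed b (y t))^-1) * y' t.
    by ring.
  have -> : speed b (y t) - (speed b (y t))^-1 = slope b (y t) ^+ 2 / speed b (y t).
    by apply: (mulIf v0); rewrite mulrBl mulVf// divfK// -expr2 v2; ring.
  by ring.
have be : bmeas a c e.
  apply: (@eq_bmeas _ _ _ (fun t => n t - S t * D' t - speed b (y t) * y' t)).
    by move=> t _; rewrite eE.
  by apply: bmeasB acLy.1; exact: bmeasB.
have kapE : Int a c e = Int a c n + G - (Lam r - Lam (- r)).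
  rewrite (eq_Int (fun t _ => eE t)) (IntB (bmeasB bn bSD) acLy.1) (IntB bn bSD) GE.
  by rewrite (ac_Int ac_ acLy)/= yc ya opprK.
have calib t : a <= t <= c ->
    [/\ 0 <= e t, n t <= 2 * y' t + 2 * e t, - y' t <= e t & `|y' t| <= n t].
  move=> tac; have v0 := speed_gt0 b (y t); have s0 := slope_ge0 b (y t).
  have v2 : speed b (y t) ^+ 2 = 1 + slope b (y t) ^+ 2.
    by rewrite sqr_sqrtr// ltW// one_plus_sqr_gt0.
  have v1 : 1 <= speed b (y t) by rewrite -{1}(@sqrtr1 R) ler_wsqrtr// lerDl sqr_ge0.
  have s1 := slope_small b5 sd (yd' _ tac).
  apply: calibration_bounds => //.
  - by rewrite divr_ge0// ltW.
  - rewrite ler_pdivrMr//; lra.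
  - by rewrite invr_ge0 ltW.
  - rewrite /S /sine expr_div_n exprVn v2 -[X in _ + X]div1r -mulrDl addrC divff// lt0r_neq0//.
    exact: one_plus_sqr_gt0.
  - exact: n0.
  - exact: nE.
have e0 t : a <= t <= c -> 0 <= e t by move=> /calib[].
have kap0 : 0 <= Int a c e by exact: Int_ge0.
have G0 : 0 < G by lra.
(* A crude bound, giving the k <= 1 that [gain_le] requires: the integrand of G is at most n, and
   the competitor is short. *)
have G1 : G <= 1.
  have G4 : G <= Int a c n.
    apply: le_Int => // t tac.
    have /andP[w0 w1] := profile_le b5 sd (yd' _ tac).
    have := xd _ tac; rewrite ler_norml => /andP[x1 x2].
    have := dslope_small b5 sd (yd' _ tac); have := dslope_ge0 b (y t) => p0 p1.
    have v1 : 1 <= speed b (y t) by rewrite -{1}(@sqrtr1 R) ler_wsqrtr// lerDl sqr_ge0.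
    have s3 : 0 <= speed b (y t) ^- 3 <= 1.
      rewrite invr_ge0 exprn_ge0 ?(le_trans _ v1)//= invf_le1 ?exprn_ege1//.
      by rewrite exprn_gt0// (lt_le_trans _ v1).
    have B25 : 1 <= (b%:R ^+ 2) ^+ 2 :> R by rewrite -!natrX ler1n !expn_gt0 (leq_trans _ b5).
    have := inv_threshold_le B25 => p2.
    have /andP[q0 q1] := s3.
    have Dn : `|D t| <= 2 by rewrite /D ler_norml; apply/andP; split; lra.
    rewrite (_ : S' t * D t =
      speed b (y t) ^- 3 * (dslope b (y t) * D t) * y' t); last by rewrite /S'; ring.
    apply: le_trans (ler_norm _) _; rewrite normrM -[leRHS]mul1r.
    apply: ler_pM => //; last exact: y'n.
    rewrite normrM (ger0_norm q0); apply: mulr_ile1 => //.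
    rewrite normrM (ger0_norm p0).
    have : dslope b (y t) * `|D t| <= 100^-1 * 2 by apply: ler_pM => //; lra.
    lra.
  lra.
have EI : Int a c (fun t => excess b (x t) (y t) * n t) <= 8 * G ^+ 3.
  apply: (@le_trans _ _ (8 * Int a c e ^+ 3)); last first.
    by rewrite ler_pM2l// ler_pXn2r ?nnegrE// ?ltW//; lra.
  apply: (excess_integral_bound ac_ (ac_excess (odd_gt0 ob) ac_ acx acy) bn be acy.1).
  - rewrite xa ya /excess min_l ?oppr_le0 ?(ltW r0)// expr0n/= sub0r sqrrN.
    by rewrite -exprM mulnC subrr.
  - by move=> t _; exact: excess_ge0.
  - exact: n0.
  - exact: e0.
  - by move=> t /calib[].
  - move=> t tac; have [gx gy] := excess_gradient ob b5 (small_mul b5 sd) (xd _ tac) (yd _ tac).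
    set E := excess _ _ _ in gx gy *.
    have E0 : 0 <= E by exact: excess_ge0.
    have hE (g : R) : 16 * g ^+ 2 <= E -> `|g| <= 4^-1 * Num.sqrt E.
      move=> h; apply: sqr_le_norm; first by rewrite mulr_ge0// sqrtr_ge0.
      rewrite exprMn sqr_sqrtr//; lra.
    have := ler_norm (excess_x b (x t) (y t) * x' t); rewrite normrM => h1.
    have := ler_norm (excess_y b (x t) (y t) * y' t); rewrite normrM => h2.
    have : `|excess_x b (x t) (y t)| * `|x' t| <= 4^-1 * Num.sqrt E * n t.
      by apply: ler_pM; rewrite ?hE ?x'n.
    have : `|excess_y b (x t) (y t)| * `|y' t| <= 4^-1 * Num.sqrt E * n t.
      by apply: ler_pM; rewrite ?hE ?y'n.
    lra.
  - exact: (excess_moment ob ac_ r0 acx acy ya yc moment).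
have [k k0 kG] : exists2 k : R, 0 < k & k ^+ 3 = G.
  exists (G `^ 3^-1); first exact: powR_gt0.
  by rewrite -powR_mulrn ?powR_ge0// -powRrM mulVf// powRr1// ltW.
have k1 : k <= 1.
  have : k ^+ 3 <= 1 ^+ 3 by rewrite kG expr1n.
  by rewrite ler_pXn2r ?nnegrE// ltW.
have k6 : k ^+ 6 = G ^+ 2 by rewrite -kG -exprM.
pose g t := k ^+ 3 / 32 * (k^-1 / (1 + (y t / k) ^+ 2)) * y' t.
have acg : ac a c (fun t => k ^+ 3 / 32 * atan (y t / k)) g.
  apply: (ac_comp ac_ (fun z => is_derive_atanZ (k ^+ 3 / 32) k z) _ acy) => z.
  apply: cvgM; first exact: cvg_cst.
  apply: cvgM; first exact: cvg_cst.
  apply: cvgV; first by rewrite lt0r_neq0// one_plus_sqr_gt0.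
  apply: cvgD; first exact: cvg_cst.
  have cq : {for z, continuous (fun z : R => z / k)}.
    by apply: cvgM; [exact: cvg_id|exact: cvg_cst].
  exact: (continuous_comp cq (@exprn_continuous R 2 _)).
(* The arctangent varies by less than pi < 4, and 4/32 = 1/8. *)
have gI : Int a c g <= G / 8.
  rewrite (ac_Int ac_ acg) kG -mulrBr.
  have := @pihalf_lt2 R => p2.
  have := atan_ltpi2 (y c / k); have := atan_gtNpi2 (y a / k) => t1 t2.
  have : G / 32 * (atan (y c / k) - atan (y a / k)) <= G / 32 * 4.
    by apply: ler_wpM2l; [rewrite divr_ge0// ltW|lra].
  lra.
have bEn : bmeas a c (fun t => excess b (x t) (y t) * n t).
  by apply: bmeasM => //; apply: ac_bmeas (ac_excess (odd_gt0 ob) ac_ acx acy).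
have : G <= 3 / 8 * Int a c e +
    (64 * k ^+ 6)^-1 * Int a c (fun t => excess b (x t) (y t) * n t) + Int a c g.
  rewrite -(IntZ _ be) -(IntZ _ bEn) -(IntD (bmeasZ _ be) (bmeasZ _ bEn)).
  rewrite -(IntD (bmeasD (bmeasZ _ be) (bmeasZ _ bEn)) acg.1).
  apply: le_Int => //.
    by apply: bmeasD acg.1; apply: bmeasD; exact: bmeasZ.
  move=> t tac; have [ce _ cy cn] := calib _ tac.
  rewrite mulrC; exact: (gain_le b5 sd ob (xd _ tac) (yd _ tac) k0 k1 ce cn cy).
(* The factor 64 turns the bound 8 G^3 into G/8. *)
have : (64 * k ^+ 6)^-1 * Int a c (fun t => excess b (x t) (y t) * n t) <= G / 8.
  apply: (@le_trans _ _ ((64 * k ^+ 6)^-1 * (8 * G ^+ 3))).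
    by apply: ler_wpM2l => //; rewrite invr_ge0 mulr_ge0// exprn_ge0// ltW.
  by rewrite k6 le_eqVlt; apply/orP; left; apply/eqP; field; rewrite lt0r_neq0.
(* As int e < G, the three shares 3/8, 1/8 and 1/8 add up to less than G. *)
lra.
Qed.

(** * The two curves *)

(** A derivative at least 1 makes L increase at least as fast as the identity, so it is a bijection
    of the line. Applied to arc length as a function of y, this yields the arc-length
    parametrization. *)
Lemma inverse_of_expanding {R : realType} (L d : R -> R) :
  (forall z : R, is_derive z (1 : R) L (d z)) -> (forall z, 1 <= d z) ->
  exists phi : R -> R, [/\ cancel L phi, cancel phi L,
    (forall t, is_derive t (1 : R) phi (d (phi t))^-1) &
    {homo phi : s t / s < t}].
Proof.
move=> dL d1.
have cL := derive_continuous dL.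
have Lexp z y : z <= y -> y - z <= L y - L z.
  move=> zy; have [x _ ->] := MVT_segment zy (fun x _ => dL x) (continuous_subspaceT cL).
  by rewrite -[leLHS]mul1r ler_wpM2r ?subr_ge0.
have Linc z y : z < y -> L z < L y by move=> zy; have := Lexp _ _ (ltW zy); lra.
have Linj : injective L.
  by move=> z y Lzy; have [/Linc|/Linc|//] := ltgtP z y; rewrite Lzy ltxx.
have Lsurj t : exists z, L z = t.
  pose M := `|t - L 0|; have M0 : 0 <= M := normr_ge0 _.
  have tM : - M <= t - L 0 <= M by rewrite -ler_norml.
  have h1 := Lexp 0 M M0; have h2 := Lexp (- M) 0 ltac:(lra).
  have ab : - M <= M by lra.
  have [|z _ zt] := @IVT _ L (- M) M t ab (continuous_subspaceT cL); last by exists z.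
  by rewrite ge_min le_max; apply/andP; split; apply/orP; [left|right]; lra.
pose phi t := projT1 (cid (Lsurj t)).
have phiK : cancel phi L by move=> t; rewrite /phi; case: cid.
have Kphi : cancel L phi by move=> z; apply: Linj; rewrite phiK.
exists phi; split => //.
- move=> t; have := @is_derive_inverse _ L phi (d (phi t)) (phi t).
  rewrite phiK; apply.
  + by near=> z; exact: Kphi.
  + by near=> z; exact: cL.
  + by rewrite lt0r_neq0// (lt_le_trans ltr01).
- move=> s t st; rewrite ltNge; apply/negP.
  by rewrite le_eqVlt => /predU1P[/(congr1 L)|/Linc]; rewrite !phiK; lra.
Unshelve. all: by end_near. Qed.

(** * Coordinates, and the frame in coordinates *)

Lemma ord2_ind (P : 'I_2 -> Prop) : P (inord 0) -> P (inord 1) -> forall i, P i.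
Proof.
move=> P0 P1 [[|[|//]] h].
  by rewrite (_ : Ordinal h = inord 0)//; apply: val_inj; rewrite /= inordK.
by rewrite (_ : Ordinal h = inord 1)//; apply: val_inj; rewrite /= inordK.
Qed.

Lemma ord3_ind (P : 'I_3 -> Prop) :
  P (inord 0) -> P (inord 1) -> P (inord 2) -> forall i, P i.
Proof.
move=> P0 P1 P2 [[|[|[|//]]] h].
- by rewrite (_ : Ordinal h = inord 0)//; apply: val_inj; rewrite /= inordK.
- by rewrite (_ : Ordinal h = inord 1)//; apply: val_inj; rewrite /= inordK.
- by rewrite (_ : Ordinal h = inord 2)//; apply: val_inj; rewrite /= inordK.
Qed.

Lemma sum_ord2 {V : nmodType} (F : 'I_2 -> V) :
  \sum_(i < 2) F i = F (inord 0) + F (inord 1).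
Proof.
rewrite big_ord_recl big_ord1; congr (F _ + F _); apply: val_inj; by rewrite /= inordK.
Qed.

Lemma sum_ord3 {V : nmodType} (F : 'I_3 -> V) :
  \sum_(i < 3) F i = F (inord 0) + (F (inord 1) + F (inord 2)).
Proof.
rewrite !big_ord_recl big_ord0 addr0.
by congr (F _ + (F _ + F _)); apply: val_inj; rewrite /= inordK.
Qed.

Lemma vec3E {R : realType} (x y z : R) :
  ((vec3 x y z ord0 (inord 0) = x) * (vec3 x y z ord0 (inord 1) = y)
   * (vec3 x y z ord0 (inord 2) = z))%type.
Proof. by rewrite /vec3 !mxE !inordK. Qed.

Lemma MframeE {R : realType} (b : nat) (x : 'rV[R]_3) :
  ((Mframe b (inord 0) x = vec3 1 0 0)
   * (Mframe b (inord 1) x = vec3 0 1 (Pb b x ^+ 2)%R))%type.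
Proof.
split; rewrite /Mframe.
  by rewrite (_ : inord 0 = ord0)//; apply: val_inj; rewrite /= inordK.
by rewrite ifF//; apply/negbTE/eqP => /(congr1 val); rewrite /= inordK.
Qed.

Lemma pairingE {R : realType} (lam v : 'rV[R]_3) : pairing lam v =
  lam ord0 (inord 0) * v ord0 (inord 0) +
  (lam ord0 (inord 1) * v ord0 (inord 1) + lam ord0 (inord 2) * v ord0 (inord 2)).
Proof. exact: sum_ord3. Qed.

Lemma cnorm2E {R : realType} (w : 'rV[R]_2) :
  cnorm w = Num.sqrt (w ord0 (inord 0) ^+ 2 + w ord0 (inord 1) ^+ 2).
Proof. by rewrite /cnorm sum_ord2. Qed.

Definition velocity {R : realType} (b : nat) (w : 'rV[R]_2) (x : 'rV[R]_3) (j : 'I_3) : R :=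
  \sum_(i < 2) w ord0 i * Mframe b i x ord0 j.

Lemma velocityE {R : realType} (b : nat) (w : 'rV[R]_2) (x : 'rV[R]_3) :
  ((velocity b w x (inord 0) = w ord0 (inord 0))
   * (velocity b w x (inord 1) = w ord0 (inord 1))
   * (velocity b w x (inord 2) = (w ord0 (inord 1) * Pb b x ^+ 2)%R))%type.
Proof. by rewrite /velocity !sum_ord2 !MframeE !vec3E !(mulr0, mulr1, addr0, add0r). Qed.

(** The first two components of the velocity are the controls themselves, so measurability and
    boundedness of the controls are contained in the first two [ac] conditions. *)
Lemma admissible_acP {R : realType} (b : nat) (a c : R) (eta : R -> 'rV[R]_3)
    (u : R -> 'rV[R]_2) :
  admissible (Mframe b) a c eta u <->
  [/\ a <= c,
    ac a c (fun t => eta t ord0 (inord 0)) (fun t => u t ord0 (inord 0)),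
    ac a c (fun t => eta t ord0 (inord 1)) (fun t => u t ord0 (inord 1)) &
    ac a c (fun t => eta t ord0 (inord 2))
      (fun t => u t ord0 (inord 1) * Pb b (eta t) ^+ 2)].
Proof.
split=> [[ac_ mu [M uM] _ etaE]|[ac_ ac0 ac1 ac2]].
  have bu i : bmeas a c (fun t => u t ord0 i).
    by split; [exact: mu|exists M => t tac; exact: uM].
  have ac0 : ac a c (fun t => eta t ord0 (inord 0)) (fun t => u t ord0 (inord 0)).
    split=> // t tac; rewrite etaE//; congr (_ + _).
    by apply: eq_Int => s _; rewrite -/(velocity _ _ _ _) velocityE.
  have ac1 : ac a c (fun t => eta t ord0 (inord 1)) (fun t => u t ord0 (inord 1)).
    split=> // t tac; rewrite etaE//; congr (_ + _).
    by apply: eq_Int => s _; rewrite -/(velocity _ _ _ _) velocityE.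
  split=> //; split.
    apply: bmeasM => //; apply: (bmeas_continuous (@exprn_continuous R 2)).
    apply: bmeasB.
      exact: (bmeas_continuous (@exprn_continuous R 2) (ac_bmeas ac_ ac0)).
    exact: (bmeas_continuous (@exprn_continuous R b) (ac_bmeas ac_ ac1)).
  move=> t tac; rewrite etaE//; congr (_ + _).
  by apply: eq_Int => s _; rewrite -/(velocity _ _ _ _) velocityE.
have acv : forall j, ac a c (fun t => eta t ord0 j) (fun t => velocity b (u t) (eta t) j).
  by apply: ord3_ind; [move: ac0|move: ac1|move: ac2];
    apply: eq_ac => // t _; rewrite velocityE.
split=> //.
- by apply: ord2_ind; [exact: ac0.1.1|exact: ac1.1.1].
- have [M0 uM0] := ac0.1.2; have [M1 uM1] := ac1.1.2.
  exists (Num.max M0 M1) => t tac.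
  by apply: ord2_ind; rewrite le_max ?uM0// uM1// orbT.
- by move=> j; exact: bmeas_integrable (acv j).1.
- by move=> t tac j; exact: (acv j).2.
Qed.

(** Turns the directional derivatives in the adjoint equation into one-variable calculus. *)
Lemma derive_along_line {R : realType} n (f : 'rV[R]_n -> R) (x v : 'rV[R]_n) (l : R) :
  is_derive (0 : R) (1 : R) (fun h => f (h *: v + x)) l -> derive f x v = l.
Proof.
move=> [_ <-]; rewrite /derive.
set g1 := fun h => h^-1 *: _; set g2 := fun h => h^-1 *: _.
suff -> : g1 = g2 by [].
by rewrite funeqE /g1 /g2 => h /=; rewrite addr0 scale0r add0r [_%:A]mulr1.
Qed.

Lemma dpair_Mframe0 {R : realType} (b : nat) (lam x : 'rV[R]_3) (j : 'I_3) :
  Defs.dpair (Mframe b (inord 0)) lam x j = 0.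
Proof.
apply: derive_along_line; apply: (@near_eq_is_derive _ _ _ (fun=> lam ord0 (inord 0))).
by near=> h; rewrite pairingE !MframeE !vec3E; ring.
Unshelve. all: by end_near. Qed.

Lemma dpair_Mframe1 {R : realType} (b : nat) (lam x : 'rV[R]_3) : (0 < b)%N ->
  let c := lam ord0 (inord 2) * (2 * Pb b x) in
  ((Defs.dpair (Mframe b (inord 1)) lam x (inord 0) = (c * (2 * x ord0 (inord 0)))%R)
   * (Defs.dpair (Mframe b (inord 1)) lam x (inord 1) = (- c * (b%:R * x ord0 (inord 1) ^+ b.-1))%R)
   * (Defs.dpair (Mframe b (inord 1)) lam x (inord 2) = 0))%type.
Proof.
move=> b0 c.
have lineE (j k : 'I_3) (h : R) : (h *: delta_mx ord0 j + x) ord0 k = h * (k == j)%:R + x ord0 k.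
  by rewrite !mxE eqxx.
have neq (k l : nat) : (k < 3)%N -> (l < 3)%N -> (inord k == inord l :> 'I_3) = (k == l).
  by move=> k3 l3; rewrite -val_eqE /= !inordK.
have pE (j : 'I_3) h : pairing lam (Mframe b (inord 1) (h *: delta_mx ord0 j + x)) =
   lam ord0 (inord 1) + lam ord0 (inord 2) *
   ((h * (inord 0 == j)%:R + x ord0 (inord 0)) ^+ 2
   - (h * (inord 1 == j)%:R + x ord0 (inord 1)) ^+ b) ^+ 2.
  by rewrite pairingE !MframeE !vec3E /Pb !lineE; ring.
(* [p] and [q] record whether the direction is that of x_1 or of x_2, so that one computation covers
   all three partial derivatives. *)
have dE (j : 'I_3) (p q : R) : (inord 0 == j)%:R = p -> (inord 1 == j)%:R = q ->
  Defs.dpair (Mframe b (inord 1)) lam x j =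
    c * (2 * x ord0 (inord 0) * p - b%:R * x ord0 (inord 1) ^+ b.-1 * q).
  move=> pp qq; apply: derive_along_line.
  have -> : (fun h : R => pairing lam (Mframe b (inord 1) (h *: delta_mx ord0 j + x))) =
    (fun h : R => lam ord0 (inord 1) + lam ord0 (inord 2) *
     ((h * p + x ord0 (inord 0)) ^+ 2 - (h * q + x ord0 (inord 1)) ^+ b) ^+ 2).
    by apply/funext => h; rewrite pE pp qq.
  have dl (k m : R) : is_derive (0 : R) (1 : R) (fun h : R => h * k + m) k.
    by apply: is_derive_eq; rewrite /GRing.scale/=; ring.
  have dX n (k m : R) : is_derive (0 : R) (1 : R) (fun h : R => (h * k + m) ^+ n.+1)
      (n.+1%:R * m ^+ n * k).
    apply: (is_derive_eq (@is_derive1_comp _ _ (fun h : R => h * k + m) 0 _ _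
      (is_derive_exprn n _) (dl k m))).
    by rewrite mul0r add0r.
  have [n bE] : exists n, b = n.+1 by exists b.-1; rewrite prednK.
  have dP : is_derive (0 : R) (1 : R)
      (fun h : R => (h * p + x ord0 (inord 0)) ^+ 2 - (h * q + x ord0 (inord 1)) ^+ b)
      (2 * x ord0 (inord 0) * p - b%:R * x ord0 (inord 1) ^+ b.-1 * q).
    have := is_deriveB (dX 1 p (x ord0 (inord 0))) (dX n q (x ord0 (inord 1))).
    by rewrite bE expr1.
  have dP2 := is_derive1_comp (is_derive_exprn 1 _) dP.
  have dP3 := is_deriveD (is_derive_cst (lam ord0 (inord 1)) (0 : R) (1 : R))
    (is_deriveZ (lam ord0 (inord 2)) dP2).
  apply: (is_derive_eq dP3); rewrite /GRing.scale/= !mul0r !add0r expr1 /c /Pb; ring.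
rewrite (dE _ 1 0) ?neq// (dE _ 0 1) ?neq// (dE _ 0 0) ?neq//.
by split; [split|]; ring.
Qed.

(** Both curves at once, with sign [sg] equal to 1 or -1. Writing the pieces with the positive and
    negative parts of y avoids a case split at y = 0, and the calculus rules apply across it. *)
Definition branch {R : realType} (b : nat) (sg : R) (y : R) : 'rV[R]_3 :=
  vec3 (sg * profile b y) y (Num.min y 0 ^+ (2 * b + 1) / (2 * b + 1)%:R).

Lemma profile_le0 {R : realType} (b : nat) (y : R) : (0 < b)%N -> y <= 0 -> profile b y = 0.
Proof. by move=> b0 y0; rewrite /profile ler0_sqrtr// expr0n eqn0Ngt b0. Qed.

Lemma profile_gt0 {R : realType} (b : nat) (y : R) : 0 < y -> 0 < profile b y.
Proof. by move=> y0; rewrite exprn_gt0// sqrtr_gt0. Qed.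

Lemma profile_powR {R : realType} (b : nat) (y : R) : 0 <= y ->
  y `^ (b%:R / 2) = profile b y.
Proof.
move=> y0; rewrite mulrC powRrM powR12_sqrt//.
by rewrite powR_mulrn// sqrtr_ge0.
Qed.

Lemma branch_cases {R : realType} (b : nat) (sg y : R) : (0 < b)%N ->
  branch b sg y = if y < 0 then vec3 0 y (y ^+ (2 * b + 1) / (2 * b + 1)%:R)
    else vec3 (sg * y `^ (b%:R / 2)) y 0.
Proof.
move=> b0; rewrite /branch; have [y0|y0] := ltP y 0.
  by rewrite profile_le0 ?mulr0// ltW.
by rewrite profile_powR// expr0n addn1/= mul0r.
Qed.

Lemma gammaME {R : realType} (b : nat) : (0 < b)%N -> @gammaM R b = branch b 1.
Proof.
by move=> b0; apply/funext => y; rewrite branch_cases// /gammaM mul1r.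
Qed.

Lemma gammabarME {R : realType} (b : nat) : (0 < b)%N -> @gammabarM R b = branch b (-1).
Proof.
by move=> b0; apply/funext => y; rewrite branch_cases// /gammabarM mulN1r.
Qed.

Lemma Pb_branch {R : realType} (b : nat) (sg y : R) : odd b -> sg ^+ 2 = 1 ->
  Pb b (branch b sg y) = - Num.min y 0 ^+ b.
Proof.
move=> ob sg1; have b0 := odd_gt0 ob.
rewrite /Pb /branch !vec3E exprMn sg1 mul1r; have [y0|y0] := leP y 0.
  by rewrite profile_le0// expr0n/= sub0r.
rewrite /profile -exprM mulnC exprM sqr_sqrtr ?ltW// subrr expr0n.
by rewrite eqn0Ngt b0 oppr0.
Qed.

(** On a branch x_1 lives on y > 0 and P on y < 0, so their product vanishes. *)
Lemma profile_min {R : realType} (b : nat) (y : R) : (0 < b)%N ->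
  profile b y * Num.min y 0 ^+ b = 0.
Proof.
move=> b0; have [y0|y0] := leP y 0; first by rewrite profile_le0// mul0r.
by rewrite expr0n eqn0Ngt b0 mulr0.
Qed.

(** P is even in x_1, so multiplying x_1 by [sg] reflects a competitor into one for the positive
    branch without changing its length or its third coordinate. *)
Lemma length_ge_branch {R : realType} (b : nat) (delta r sg : R) (Lam : R -> R)
    (a c : R) (eta : R -> 'rV[R]_3) (u : R -> 'rV[R]_2) :
  odd b -> (5 <= b)%N -> small b delta -> 0 < r -> 10 * r <= delta -> sg ^+ 2 = 1 ->
  (forall z : R, is_derive z (1 : R) Lam (speed b z)) ->
  admissible (Mframe b) a c eta u ->
  eta a = branch b sg (- r) -> eta c = branch b sg r ->
  Lam r - Lam (- r) <= sr_length u a c.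
Proof.
move=> ob b5 sd r0 rd sg1 dLam /admissible_acP[ac_ ac0 ac1 ac2] ea ec.
have b0 := odd_gt0 ob.
have bn : bmeas a c (fun t => cnorm (u t)).
  apply: (@eq_bmeas _ _ _ (fun t => Num.sqrt (u t ord0 (inord 0) ^+ 2 + u t ord0 (inord 1) ^+ 2))).
    by move=> t _; rewrite cnorm2E.
  apply: (bmeas_continuous (@sqrt_continuous R)); apply: bmeasD.
    exact: (bmeas_continuous (@exprn_continuous R 2) ac0.1).
  exact: (bmeas_continuous (@exprn_continuous R 2) ac1.1).
apply: (length_lower_bound ob b5 sd r0 rd dLam ac_ (acZ sg ac0) ac1 bn).
- by move=> t _; exact: sqrtr_ge0.
- move=> t _; rewrite cnorm2E sqr_sqrtr; first by rewrite exprMn sg1 mul1r.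
  by rewrite addr_ge0// sqr_ge0.
- by rewrite ea /branch vec3E profile_le0 ?oppr_le0 ?ltW// !mulr0.
- by rewrite ea /branch vec3E.
- by rewrite ec /branch vec3E mulrA -expr2 sg1 mul1r.
- by rewrite ec /branch vec3E.
have := ac_Int ac_ ac2; rewrite ea ec /branch !vec3E min_r ?(ltW r0)//.
have om : odd (2 * b + 1) by rewrite addn1 /= oddM.
have z0 : (0 : R) ^+ (2 * b + 1) = 0 by rewrite addn1 expr0n.
rewrite min_l ?oppr_le0 ?(ltW r0)// z0 mul0r sub0r.
rewrite exprNn -signr_odd om expr1 !mulN1r mulNr opprK => <-.
by apply: eq_Int => t _; rewrite /Pb exprMn sg1 mul1r.
Qed.

(** * A branch parametrized by arc length: minimality, abnormality, failure of normality *)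

Section branch_curve.
Context {R : realType} (b : nat) (delta r sg : R) (Lam phi : R -> R).
Hypotheses (ob : odd b) (b5 : (5 <= b)%N) (sd : small b delta).
Hypotheses (r0 : 0 < r) (rd : 10 * r <= delta) (sg1 : sg ^+ 2 = 1).
Hypothesis dLam : forall z : R, is_derive z (1 : R) Lam (speed b z).
Hypothesis LamK : cancel Lam phi.
Hypothesis dphi : forall t : R, is_derive t (1 : R) phi (speed b (phi t))^-1.
Hypothesis phi_lt : {homo phi : s t / s < t}.
Hypothesis Lam_start : Lam (- r) = 0.

Let T : R := Lam r.
Let eta : R -> 'rV[R]_3 := branch b sg \o phi.
Let v (t : R) : R := (speed b (phi t))^-1.
Let control (t : R) : 'rV[R]_2 :=
  \row_(j < 2) [:: sg * (slope b (phi t) * v t); v t]`_j.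

Let phi0 : phi 0 = - r. Proof. by rewrite -Lam_start LamK. Qed.

Let phiT : phi T = r. Proof. exact: LamK. Qed.

Let b0 : (0 < b)%N := odd_gt0 ob.

Lemma arrival_gt0 : 0 < T.
Proof.
rewrite ltNge; apply/negP; rewrite le_eqVlt => /predU1P[T0|/phi_lt].
  by move: r0; have := phiT; rewrite T0 phi0; lra.
by rewrite phiT phi0; move: r0; lra.
Qed.

Lemma passage_between : 0 < Lam 0 < T.
Proof.
apply/andP; split; rewrite ltNge; apply/negP.
- rewrite le_eqVlt => /predU1P[L0|/phi_lt]; last by move: r0; rewrite LamK phi0; lra.
  by move: r0; have := LamK 0; rewrite L0 phi0; lra.
- rewrite le_eqVlt => /predU1P[L0|/phi_lt]; last by move: r0; rewrite LamK phiT; lra.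
  by move: r0; have := LamK 0; rewrite -L0 phiT; lra.
Qed.

Let v_continuous : continuous v.
Proof.
move=> t; apply: cvgV; first by rewrite lt0r_neq0// speed_gt0.
have cphi : {for t, continuous phi} by exact: (derive_continuous dphi).
exact: (continuous_comp cphi (@speed_continuous R b (phi t))).
Qed.

Let ac_phi t : 0 <= t -> ac 0 t phi v.
Proof. by move=> t0; exact: (ac_C1 t0 dphi v_continuous). Qed.

Lemma branch_admissible : admissible (Mframe b) 0 T eta control.
Proof.
have T0 := ltW arrival_gt0; have acp := ac_phi T0.
have cE t : (control t ord0 (inord 0) = sg * (slope b (phi t) * v t))
  * (control t ord0 (inord 1) = v t) by rewrite /control !mxE !inordK.
apply/admissible_acP; split => //.
- have := acZ sg (ac_comp T0 (fun z => is_derive_profile z b5) (@slope_continuous R b) acp).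
  by apply: eq_ac => // t _; rewrite ?cE// /eta /= /branch vec3E.
- by move: acp; apply: eq_ac => // t _; rewrite ?cE// /eta /= /branch vec3E.
- have [m mE] : exists m, b = m.+1 by exists b.-1; rewrite prednK.
  have := acZ ((2 * b + 1)%:R^-1) (ac_minX (2 * m + 1) T0 acp).
  have e1 : (2 * b + 1 = (2 * m + 1).+2)%N by rewrite mE; lia.
  apply: eq_ac => // t _; rewrite ?cE.
    by rewrite /eta /= /branch vec3E -e1 mulrC.
  rewrite /eta /= Pb_branch// sqrrN -exprM -e1 -mulrA mulKf ?e1 ?pnatr_eq0//.
  by rewrite mulrC; congr (_ * _ ^+ _); rewrite mE; lia.
Qed.

Lemma branch_unit_speed t : cnorm (control t) = 1.
Proof.
rewrite cnorm2E /control !mxE !inordK//= exprMn sg1 mul1r exprMn.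
rewrite -[X in _ + X]mul1r -mulrDl addrC /v exprVn.
rewrite [X in _ / X]sqr_sqrtr ?ltW ?one_plus_sqr_gt0//.
by rewrite divff ?sqrtr1// lt0r_neq0// one_plus_sqr_gt0.
Qed.

Lemma branch_minimizing : minimizing_geodesic (Mframe b) T eta.
Proof.
exists control; split; [exact: branch_admissible|by move=> t _; exact: branch_unit_speed|].
apply/eqP; rewrite eq_le; apply/andP; split.
  apply: ereal_inf_lbound; exists 0, T, eta, control; split => //.
    exact: branch_admissible.
  congr (_%:E); rewrite /sr_length (_ : (fun t => cnorm (control t)) = fun=> 1).
    by rewrite [RHS](Int_cst 1 (ltW arrival_gt0)) subr0 mul1r.
  by apply/funext => t; rewrite branch_unit_speed.
apply: le_ereal_inf_tmp => _ [a [c [eta' [u [adm ea ec ->]]]]].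
rewrite lee_fin /T -[Lam r]subr0 -Lam_start.
apply: (length_ge_branch ob b5 sd r0 rd sg1 dLam adm).
  by rewrite ea /eta /= phi0.
by rewrite ec /eta /= phiT.
Qed.

(** Along a branch P^2 = min(x_2, 0)^(2b), so this is (0, -P^2, 1): up to scaling, the covector
    annihilating both fields of the frame. *)
Let dual (t : R) : 'rV[R]_3 := vec3 0 (- Num.min (phi t) 0 ^+ (2 * b)) 1.

(** The derivative of P^2 in x_1 is 4 x_1 P, so this identity makes the first component of every
    solution of the adjoint equation constant. *)
Lemma branch_x1_Pb t : eta t ord0 (inord 0) * Pb b (eta t) = 0.
Proof.
by rewrite /eta /= Pb_branch// /branch vec3E mulrN -mulrA profile_min// mulr0 oppr0.
Qed.

Lemma branch_abnormal : abnormal_extremal (Mframe b) T eta.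
Proof.
have T0 := ltW arrival_gt0.
exists control, dual.
have cE t : control t ord0 (inord 1) = v t by rewrite /control !mxE !inordK.
have [m mE] : exists m, (2 * b = m.+2)%N by exists (2 * b).-2; case: (b) b0 => // k; rewrite mulnS.
pose F (j : 'I_3) (s : R) := \sum_(i < 2) control s ord0 i * Defs.dpair (Mframe b i) (dual s) (eta s) j.
have FE j s : F j s = v s * Defs.dpair (Mframe b (inord 1)) (dual s) (eta s) j.
  by rewrite /F sum_ord2 dpair_Mframe0 mulr0 add0r cE.
have F0 s : F (inord 0) s = 0.
  rewrite FE dpair_Mframe1// /dual vec3E mul1r.
  rewrite (_ : _ * (2 * _ * _) = 4 * v s * (eta s ord0 (inord 0) * Pb b (eta s))); last by ring.
  by rewrite branch_x1_Pb mulr0.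
have F2 s : F (inord 2) s = 0 by rewrite FE dpair_Mframe1// mulr0.
have F1 s : F (inord 1) s = m.+2%:R * Num.min (phi s) 0 ^+ m.+1 * v s.
  rewrite FE dpair_Mframe1// /dual vec3E mul1r /eta /= Pb_branch// /branch vec3E.
  rewrite -mE natrM.
  have [y0|y0] := leP (phi s) 0; last first.
    by rewrite !expr0n eqn0Ngt b0/=; ring.
  have -> : phi s ^+ m.+1 = phi s ^+ b * phi s ^+ b.-1.
    by rewrite -exprD; congr (_ ^+ _); lia.
  by ring.
(* The adjoint equation carries a minus sign, hence the opposite of [dual]. *)
have acF j : ac 0 T (fun t => - dual t ord0 j) (F j).
  move: j; apply: ord3_ind.
  - by have := ac_cst 0 T (0 : R); apply: eq_ac => // t _; rewrite ?F0// /dual vec3E oppr0.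
  - have := ac_minX m T0 (ac_phi T0).
    by apply: eq_ac => // t _; rewrite ?F1// /dual vec3E opprK mE.
  - by have := ac_cst 0 T (- 1 : R); apply: eq_ac => // t _; rewrite ?F2// /dual vec3E.
split.
- exact: branch_admissible.
- split => [j|t tT j]; first exact: bmeas_integrable (acF j).1.
  have := (acF j).2 _ tT; rewrite /Int -/(F j) => h.
  by rewrite -[LHS]opprK h opprD opprK.
- move=> t _; apply/eqP => /rowP/(_ (inord 2)).
  by rewrite /dual vec3E mxE; apply/eqP; rewrite oner_eq0.
- move=> t _; apply: ord2_ind; rewrite pairingE !MframeE /dual !vec3E.
    by rewrite !mul0r !mulr0 !addr0.
  by rewrite /eta /= Pb_branch// sqrrN -exprM mulnC; ring.
Qed.

(* Since x_1 P = 0 the first component of a covector is constant, hence so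
   would be the control x_1', although x_1 is zero exactly up to the branching time. *)
Lemma branch_not_normal : ~ normal_extremal (Mframe b) T eta.
Proof.
move=> [u [lam [/admissible_acP[T0 ac0 _ _] [_ lamE] uE]]].
have lam0 t : 0 <= t <= T -> lam t ord0 (inord 0) = lam 0 ord0 (inord 0).
  move=> tT; rewrite lamE// -[RHS]subr0; congr (_ - _).
  transitivity (Int 0 t (fun=> 0 : R)); last by rewrite Int_cst ?mul0r//; case/andP: tT.
  apply: eq_Int => s _; rewrite sum_ord2 dpair_Mframe0 mulr0 add0r dpair_Mframe1//.
  rewrite (_ : _ * (_ * _) = 4 * u s ord0 (inord 1) * lam s ord0 (inord 2) *
    (eta s ord0 (inord 0) * Pb b (eta s))); last by ring.
  by rewrite branch_x1_Pb mulr0.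
have x1E t : 0 <= t <= T -> eta t ord0 (inord 0) = lam 0 ord0 (inord 0) * t.
  move=> /[dup] tT /andP[t0 tT']; rewrite (ac0.2 _ tT) /eta /= phi0 /branch vec3E.
  rewrite profile_le0 ?oppr_le0 ?ltW// mulr0 add0r -[X in _ = _ * X]subr0 -Int_cst//.
  apply: eq_Int => s /andP[s0 st]; have sT : 0 <= s <= T by rewrite s0 (le_trans st).
  by rewrite uE// pairingE MframeE !vec3E lam0// mulr1 !mulr0 !addr0.
have /andP[L0 LT] := passage_between.
have c0 : lam 0 ord0 (inord 0) = 0.
  have := x1E (Lam 0); rewrite (ltW L0) (ltW LT) => /(_ isT).
  rewrite /eta /= LamK /branch vec3E profile_le0// mulr0 => /esym/eqP.
  by rewrite mulf_eq0 (gt_eqF L0) orbF => /eqP.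
have := x1E T; rewrite T0 lexx => /(_ isT); rewrite c0 mul0r /eta /= phiT /branch vec3E.
move=> /eqP; rewrite mulf_eq0 (gt_eqF (profile_gt0 b r0)) orbF => /eqP sg0.
by move: sg1; rewrite sg0 expr0n/= => /eqP; rewrite eq_sym oner_eq0.
Qed.

End branch_curve.

Unset Implicit Arguments.
Set Strict Implicit.

(* phi : [0,T] -> [-s,eps] is the (common) arc-length reparametrization,
   t0 = phi^{-1}(0) the branching time. *)
Theorem theorem1p2 (R : realType) (b : nat) (hb_odd : odd b) (hb5 : (5 <= b)%N) :
  exists s eps : R, 0 < s /\ 0 < eps /\
  exists (T t0 : R) (phi : R -> R),
    [/\ 0 < t0 < T, phi 0 = - s, phi t0 = 0 & phi T = eps] /\
    {within `[0, T], continuous phi} /\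
    {in `[0, T] &, forall x y, x < y -> phi x < phi y} /\
    let eta := gammaM b \o phi in
    let etabar := gammabarM b \o phi in
    [/\ minimizing_geodesic (Mframe (R:=R) b) T eta /\ strictly_abnormal (Mframe (R:=R) b) T eta,
        minimizing_geodesic (Mframe (R:=R) b) T etabar /\ strictly_abnormal (Mframe (R:=R) b) T etabar,
        (forall t, 0 <= t <= t0 -> eta t = etabar t) &
        (forall tau, t0 < tau <= T -> exists t, 0 <= t <= tau /\ eta t != etabar t)].
Proof.
have [delta sd] := @exists_small R b; have d0 := sd.1.
have b0 := odd_gt0 hb_odd.
pose r := delta / 10; have r0 : 0 < r by rewrite divr_gt0.
have rd : 10 * r <= delta by rewrite /r; lra.
have [L dL] := continuous_primitive (@speed_continuous R b).
(* Arc length measured from height -r. The slopes of the two branches differ only in sign, so one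
   parametrization serves both. *)
pose Lam z := L z - L (- r).
have dLam z : is_derive z (1 : R) Lam (speed b z).
  by apply: (is_derive_eq (is_deriveB (dL z) (is_derive_cst (L (- r)) z 1))); rewrite subr0.
have Lam0 : Lam (- r) = 0 by rewrite /Lam subrr.
have sp1 z : 1 <= speed b z :> R by rewrite -{1}(@sqrtr1 R) ler_wsqrtr// lerDl sqr_ge0.
have [phi [LamK phiK dphi phi_lt]] := inverse_of_expanding dLam sp1.
have phi0 : phi 0 = - r by rewrite -Lam0 LamK.
have /andP[L0 LT] := passage_between r0 LamK phi_lt Lam0.
have geo sg : sg ^+ 2 = 1 -> minimizing_geodesic (Mframe b) (Lam r) (branch b sg \o phi) /\
    strictly_abnormal (Mframe b) (Lam r) (branch b sg \o phi).
  move=> sg1; split; first exact: (branch_minimizing hb_odd hb5 sd r0 rd sg1 dLam).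
  split; first exact: (branch_abnormal hb_odd hb5 r0 rd sg1).
  exact: (branch_not_normal hb_odd r0 sg1).
exists r, r; split=> //; split=> //; exists (Lam r), (Lam 0), phi.
split; first by split; [rewrite L0 LT|exact: phi0|exact: LamK|exact: LamK].
split; first by apply: continuous_subspaceT; exact: derive_continuous dphi.
split; first by move=> x y _ _; exact: phi_lt.
rewrite /= gammaME// gammabarME//; split.
- by apply: geo; rewrite expr1n.
- by apply: geo; rewrite sqrrN expr1n.
- move=> t /andP[t0 tL] /=.
  have : phi t <= 0.
    move: tL; rewrite le_eqVlt => /predU1P[->|/phi_lt]; rewrite LamK// => /ltW.
    by [].
  by move=> ple; rewrite /branch profile_le0// !mulr0.
(* The time [tau] itself is a witness: there y > 0, and the first coordinates are opposite and
   nonzero. *)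
- move=> tau /andP[tL tT]; exists tau; split; first by rewrite lexx (ltW (lt_trans L0 tL)).
  have p0 : 0 < phi tau by have := phi_lt _ _ tL; rewrite LamK.
  apply/eqP => /rowP/(_ (inord 0)); rewrite /= /branch !vec3E mul1r mulN1r.
  by have := profile_gt0 b p0; lra.
Qed.
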